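(* Let $\mathcal{U}$ be a multiplicative global family. Then the torsion-free injective objects of $\mathcal{A}\mathcal{U}$ coincide with the projective objects of $\mathcal{A}\mathcal{U}$; that is, an object of $\mathcal{A}\mathcal{U}$ is projective if and only if it is both torsion-free and injective.
   Context: Fix a field $k$ of characteristic zero. $\mathcal{G}$ is the category whose objects are finite groups and whose morphisms are conjugacy classes of surjective group homomorphisms. A subcategory of $\mathcal{G}$ is always full and replete. For $\mathcal{U}\le\mathcal{G}$, $\mathcal{A}\mathcal{U}=[\mathcal{U}^{\mathrm{op}},\mathrm{Vect}_k]$. $\mathcal{U}$ is multiplicative if $1\in\mathcal{U}$ and $\mathcal{U}$ is closed under binary products; it is a global family if it is closed under passage to subgroups and to quotient groups. An object $X\in\mathcal{A}\mathcal{U}$ is torsion-free if for every morphism $\alpha\in\mathcal{U}(H,G)$ the map $\alpha^*\colon X(G)\to X(H)$ is injective. *)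

(* Defs.v *)
From HB Require Import structures.
From mathcomp Require Import all_boot all_order all_algebra all_fingroup boolp.

Set Implicit Arguments.
Unset Strict Implicit.
Unset Printing Implicit Defensive.

Local Open Scope group_scope.

Record category := Category {
  obj :> Type;
  hom : obj -> obj -> Type;
  idm : forall x, hom x x;
  comp : forall x y z, hom y z -> hom x y -> hom x z;
  comp_idl : forall x y (f : hom x y), comp (idm y) f = f;
  comp_idr : forall x y (f : hom x y), comp f (idm x) = f;
  compA : forall x y z t (h : hom z t) (g : hom y z) (f : hom x y),
    comp h (comp g f) = comp (comp h g) f }.

Arguments hom {c}.
Arguments idm {c}.
Arguments comp {c x y z}.

Definition opposite (C : category) : category :=
  @Category C (fun x y => hom y x) idm (fun x y z g f => comp f g)
    (fun x y f => comp_idr f) (fun x y f => comp_idl f)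
    (fun x y z t h g f => esym (compA f g h)).

Definition full_subcategory (C : category) (P : C -> Prop) : category :=
  @Category {x : C | P x} (fun x y => hom (sval x) (sval y))
    (fun x => idm (sval x)) (fun x y z g f => comp g f)
    (fun x y f => comp_idl f) (fun x y f => comp_idr f)
    (fun x y z t h g f => compA h g f).

Section Morphisms.
Variable C : category.
Implicit Types x y z : C.

Definition isomorphic x y : Prop :=
  exists f : hom x y, exists g : hom y x,
    comp g f = idm x /\ comp f g = idm y.

Definition monic x y (f : hom x y) : Prop :=
  forall z (g h : hom z x), comp f g = comp f h -> g = h.

Definition epic x y (f : hom x y) : Prop :=
  forall z (g h : hom y z), comp g f = comp h f -> g = h.

Definition projective (p : C) : Prop :=
  forall x y (e : hom x y) (f : hom p y), epic e ->
    exists g : hom p x, comp e g = f.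

Definition injective_object (i : C) : Prop :=
  forall x y (m : hom x y) (f : hom x i), monic m ->
    exists g : hom y i, comp g m = f.

Definition replete (P : C -> Prop) : Prop :=
  forall x y, isomorphic x y -> P x -> P y.

End Morphisms.

Section FunctorCategory.
Variables C D : category.

Record functor := Functor {
  fobj :> C -> D;
  fmap : forall x y, hom x y -> hom (fobj x) (fobj y);
  fmap_id : forall x, fmap (idm x) = idm (fobj x);
  fmap_comp : forall x y z (g : hom y z) (f : hom x y),
    fmap (comp g f) = comp (fmap g) (fmap f) }.

Record nat_trans (F G : functor) := NatTrans {
  component :> forall x, hom (F x) (G x);
  naturality : forall x y (f : hom x y),
    comp (component y) (fmap F f) = comp (fmap G f) (component x) }.

Lemma nat_transP (F G : functor) (s t : nat_trans F G) :
  (forall x, s x = t x) -> s = t.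
Proof.
case: s t => [s sP] [t tP] /= st.
have E : s = t by apply: functional_extensionality_dep.
by case: _ / E in tP st *; congr NatTrans; exact: Prop_irrelevance.
Qed.

Lemma nat_id_subproof (F : functor) x y (f : hom x y) :
  comp (idm (F y)) (fmap F f) = comp (fmap F f) (idm (F x)).
Proof. by rewrite comp_idl comp_idr. Qed.

Definition nat_id (F : functor) : nat_trans F F :=
  NatTrans (@nat_id_subproof F).

Lemma nat_comp_subproof (F G H : functor)
    (t : nat_trans G H) (s : nat_trans F G) x y (f : hom x y) :
  comp (comp (t y) (s y)) (fmap F f) = comp (fmap H f) (comp (t x) (s x)).
Proof. by rewrite -compA naturality compA naturality compA. Qed.

Definition nat_comp (F G H : functor)
    (t : nat_trans G H) (s : nat_trans F G) : nat_trans F H :=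
  NatTrans (nat_comp_subproof t s).

Definition functor_category : category.
Proof.
refine (@Category functor nat_trans nat_id nat_comp _ _ _).
- by move=> F G s; apply: nat_transP => x; exact: comp_idl.
- by move=> F G s; apply: nat_transP => x; exact: comp_idr.
- by move=> F G H K u t s; apply: nat_transP => x; exact: compA.
Defined.

End FunctorCategory.

Section Vect.
Variable k : fieldType.

Lemma linearP_eq (V W : lmodType k) (f g : {linear V -> W}) :
  f =1 g -> f = g.
Proof.
case: f g => [f [[[cf1 cf1']] [cf2]]] [g [[[cg1 cg1']] [cg2]]] /= /funext fg.
case: _ / fg in cg1 cg1' cg2 *.
by rewrite (Prop_irrelevance cf1 cg1) (Prop_irrelevance cf1' cg1')
           (Prop_irrelevance cf2 cg2).
Qed.

Definition Vect : category.
Proof.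
refine (@Category (lmodType k) (fun V W => {linear V -> W})
  (fun V => idfun) (fun U V W g f => g \o f) _ _ _);
  by move=> *; exact: linearP_eq.
Defined.

End Vect.

Section FiniteGroups.
Implicit Types G H K L : finGroupType.

Definition is_surjhom H G (f : {ffun H -> G}) : bool :=
  morphic [set: H] f && (f @: [set: H] == [set: G]).

(* The inner automorphisms of the target suffice: for a homomorphism [f],
   precomposing with conjugation by [h] is postcomposing with conjugation
   by [f h]. *)
Definition conjugacy_class H G (f : {ffun H -> G}) : {set {ffun H -> G}} :=
  [set [ffun x => f x ^ g] | g in [set: G]].

Definition is_surjhom_class H G (A : {set {ffun H -> G}}) : bool :=
  [exists f, is_surjhom f && (A == conjugacy_class f)].

(* A morphism is literally a conjugacy class: the set of its representatives,
   each a group homomorphism given by its underlying finite function. *)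
Definition group_hom H G := {A : {set {ffun H -> G}} | is_surjhom_class A}.

Definition ffun_id G : {ffun G -> G} := [ffun x => x].

Definition ffun_comp K H G (f : {ffun H -> G}) (e : {ffun K -> H}) :
  {ffun K -> G} := [ffun x => f (e x)].

Lemma is_surjhomP H G (f : {ffun H -> G}) :
  reflect ({morph f : x y / x * y} /\ forall z, exists x, f x = z)
          (is_surjhom f).
Proof.
apply: (iffP andP) => [[/morphicP fM /eqP fS]|[fM fS]]; split.
- by move=> x y; rewrite fM ?inE.
- move=> z; have : z \in f @: [set: H] by rewrite fS inE.
  by case/imsetP=> x _ ->; exists x.
- by apply/morphicP => x y _ _; exact: fM.
- apply/eqP/setP => z; rewrite inE; have [x <-] := fS z.
  by rewrite imset_f ?inE.
Qed.

Lemma is_surjhom_id G : is_surjhom (ffun_id G).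
Proof.
apply/is_surjhomP; split=> [x y|z]; first by rewrite !ffunE.
by exists z; rewrite ffunE.
Qed.

Lemma is_surjhom_comp K H G (f : {ffun H -> G}) (e : {ffun K -> H}) :
  is_surjhom f -> is_surjhom e -> is_surjhom (ffun_comp f e).
Proof.
move=> /is_surjhomP[fM fS] /is_surjhomP[eM eS]; apply/is_surjhomP; split.
  by move=> x y; rewrite !ffunE eM fM.
by move=> z; have [y <-] := fS z; have [x <-] := eS y; exists x; rewrite ffunE.
Qed.

Definition class_of H G (f : {ffun H -> G}) (fP : is_surjhom f) :
  group_hom H G.
Proof.
exists (conjugacy_class f).
by apply/existsP; exists f; rewrite fP eqxx.
Defined.

Lemma group_homP H G (a : group_hom H G) :
  exists f (fP : is_surjhom f), a = class_of fP.
Proof.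
case: a => A AP; have /existsP[f /andP[fP /eqP E]] := AP.
by exists f, fP; apply: val_inj.
Qed.

Definition class_comp K H G (B : {set {ffun H -> G}})
    (A : {set {ffun K -> H}}) : {set {ffun K -> G}} :=
  [set ffun_comp f e | f in B, e in A].

Lemma class_comp_conjugacy K H G (f : {ffun H -> G}) (e : {ffun K -> H}) :
  is_surjhom f ->
  class_comp (conjugacy_class f) (conjugacy_class e) =
  conjugacy_class (ffun_comp f e).
Proof.
move=> /is_surjhomP[fM fS].
have f1 : f 1 = 1 by apply: (mulgI (f 1)); rewrite -fM !mulg1.
have fV x : f x^-1 = (f x)^-1.
  by apply: (mulgI (f x)); rewrite -fM !mulgV.
apply/setP => u; apply/imset2P/imsetP.
- case=> _ _ /imsetP[g _ ->] /imsetP[h _ ->] ->.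
  exists (f h * g); rewrite ?inE //; apply/ffunP => x; rewrite !ffunE.
  by rewrite conjgM !conjgE !fM fV !mulgA.
- case=> g _ ->.
  exists [ffun x => f x ^ g] e.
  + by apply: imset_f; rewrite inE.
  + apply/imsetP; exists 1; rewrite ?inE //.
    by apply/ffunP => x; rewrite ffunE conjg1.
  + by apply/ffunP => x; rewrite !ffunE.
Qed.

Lemma is_surjhom_class_comp K H G (b : group_hom H G) (a : group_hom K H) :
  is_surjhom_class (class_comp (val b) (val a)).
Proof.
have [f [fP ->]] := group_homP b; have [e [eP ->]] := group_homP a.
apply/existsP; exists (ffun_comp f e).
by rewrite is_surjhom_comp //= class_comp_conjugacy.
Qed.

Definition group_comp K H G (b : group_hom H G) (a : group_hom K H) :
  group_hom K G := exist (fun A => is_surjhom_class A) _ (is_surjhom_class_comp b a).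

Definition group_id G : group_hom G G := class_of (is_surjhom_id G).

Lemma group_comp_class K H G (f : {ffun H -> G}) (e : {ffun K -> H})
    (fP : is_surjhom f) (eP : is_surjhom e) :
  group_comp (class_of fP) (class_of eP) = class_of (is_surjhom_comp fP eP).
Proof. by apply: val_inj; rewrite /= class_comp_conjugacy. Qed.

Lemma class_of_eq H G (f g : {ffun H -> G})
    (fP : is_surjhom f) (gP : is_surjhom g) :
  f = g -> class_of fP = class_of gP.
Proof. by move=> fg; apply: val_inj; rewrite /= fg. Qed.

Definition FinGrp : category.
Proof.
refine (@Category finGroupType group_hom group_id group_comp _ _ _).
- move=> H G a; have [f [fP ->]] := group_homP a.
  rewrite group_comp_class; apply: class_of_eq.
  by apply/ffunP => x; rewrite !ffunE.
- move=> H G a; have [f [fP ->]] := group_homP a.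
  rewrite group_comp_class; apply: class_of_eq.
  by apply/ffunP => x; rewrite !ffunE.
- move=> L K H G c b a.
  have [h [hP ->]] := group_homP c; have [g [gP ->]] := group_homP b.
  have [f [fP ->]] := group_homP a.
  rewrite !group_comp_class; apply: class_of_eq.
  by apply/ffunP => x; rewrite !ffunE.
Defined.

End FiniteGroups.

Section Families.
Variable U : FinGrp -> Prop.

(* ['I_1] carries the trivial group structure of the integers modulo 1. *)
Definition multiplicative_family : Prop :=
  U 'I_1 /\ forall G H : finGroupType, U G -> U H -> U (G * H)%type.

(* A quotient of [G] is [coset_of N] for [N] normal in the whole of [G]:
   for other [N], [coset_of N] is a quotient of the normaliser of [N]. *)
Definition global_family : Prop :=
  (forall (G : finGroupType) (H : {group G}), U G -> U (subg_of H)) /\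
  (forall (G : finGroupType) (N : {group G}),
     N <| [set: G] -> U G -> U (coset_of N)).

Variable k : fieldType.

Definition AU : category :=
  functor_category (opposite (full_subcategory U)) (Vect k).

Definition torsion_free (X : AU) : Prop :=
  forall (H G : full_subcategory U) (a : hom H G),
    injective (fmap X a : {linear X G -> X H}).

End Families.

(* Main.v *)
Require Import Defs.
From HB Require Import structures.
From mathcomp Require Import all_boot all_order all_algebra all_fingroup.
From mathcomp Require Import boolp.
From mathcomp Require classical_sets.

(** Write k[U(-,G)] for the functor represented by G. For a family of vector
    spaces V_i indexed by the isomorphism classes of groups G_i in U, consider
    the free object F = prod_i V_i (x) k[U(-,G_i)]. A finite group has finitely
    many quotients, so at each group only finitely many factors are nonzero and
    F is a direct sum as well as a product. As a direct sum it is projective: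
    maps out of F are families of linear maps V_i -> X(G_i). It is torsion-free,
    because composition with a surjection is injective on morphisms. Every
    object is a quotient of a free one. The theorem therefore follows from two
    facts: free objects are injective, and every torsion-free object embeds in
    a free one. For then a projective object is a retract of a free object, and
    an object that is torsion-free and injective is one too.

    Both facts ask for maps X -> V (x) k[U(-,G)]. Reading off coefficients, such
    a map is a family of linear maps psi_f : X(T) -> V, one for every surjection
    f : T -> G, with psi_(f a) (a^* x) = psi_f (x) for every surjection a into
    T, and with psi_f (a^* x) = 0 if f does not factor through a. Families with
    the first property are called cocones here.

    Cocones with prescribed values are found by linear algebra
    ([cocone_exists]): it has to be shown that the prescribed values do not
    contradict each other, and a contradiction involves finitely many groups
    only. For these there is a group K in U (a relatively free group of large
    rank, built inside a product) such that, for any surjection a : S -> T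
    between them, each surjection K -> T is a o d for the same number of
    surjections d : K -> S ([homogeneous_cover]). This is the lemma of Gaschuetz
    ([card_generating_lifts]): under S -> T, all generating tuples of T have
    the same number of generating lifts. Hence averaging d^* x over
    the surjections d from K over G, which is possible in characteristic zero,
    is compatible with all the relations and carries the contradiction into
    X(K), where there is none.

    The second property is enforced by a projection ([reduction]). For N normal in G,
    let E_N psi be obtained by pulling back to the group of pairs (t, g) with
    f(t) and g congruent modulo N. These operators satisfy E_N E_M = E_(NM), so
    the product of the 1 - E_N over all N <> 1 projects onto the cocones that
    all these E_N kill, called reduced. These are the cocones that also have the
    second property ([reduced_pull]).

    Injectivity: a map from a subobject of Y to V (x) k[U(-,G)] prescribes
    values of a cocone on Y; a solution, once reduced, is an extension
    ([free_functor_injective]). Embedding: if X is torsion-free and x in X(T)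
    is nonzero, then the values c f^* x |-> c are consistent, so there is a
    cocone over T with psi_id (x) = 1. Among all quotients G of T with a cocone
    that is nonzero on x take a smallest one; minimality makes every E_N vanish
    on x there, so the value survives the reduction
    ([reduced_separation]). *)

Set Implicit Arguments.
Unset Strict Implicit.
Unset Printing Implicit Defensive.

Import GRing.Theory.

(** * Linear relations and products of vector spaces *)

Section LinearMaps.
Local Open Scope ring_scope.
Variables (k : fieldType) (V W : lmodType k).

Definition linear_of (f : V -> W) (fL : linear f) : {linear V -> W} :=
  HB.pack_for {linear V -> W} f (GRing.isLinear.Build k V W *:%R f fL).

Lemma linear_ofE (f : V -> W) (fL : linear f) : linear_of fL =1 f.
Proof. by []. Qed.

Definition linear_relation (R : V -> W -> Prop) : Prop :=
  R 0 0 /\ forall c x y a b, R x a -> R y b -> R (c *: x + y) (c *: a + b).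

Lemma linear_relationZ R c x a : linear_relation R -> R x a -> R (c *: x) (c *: a).
Proof. by move=> [R0 RL] Rxa; rewrite -[c *: x]addr0 -[c *: a]addr0; apply: RL. Qed.

Lemma linear_relationD R x y a b :
  linear_relation R -> R x a -> R y b -> R (x + y) (a + b).
Proof.
by move=> [_ RL] Rxa Ryb; rewrite -[x]scale1r -[a]scale1r; apply: RL.
Qed.

Lemma linear_relationN R x a : linear_relation R -> R x a -> R (- x) (- a).
Proof. by move=> RL Rxa; rewrite -!scaleN1r; apply: linear_relationZ. Qed.

Lemma linear_relation_sum R (J : Type) (s : seq J) (P : pred J) x a :
  linear_relation R -> (forall j, P j -> R (x j) (a j)) ->
  R (\sum_(j <- s | P j) x j) (\sum_(j <- s | P j) a j).
Proof.
move=> RL Rxa; elim/big_rec2: _ => [|j u w Pj Ruw]; first by case: RL.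
exact: linear_relationD RL (Rxa j Pj) Ruw.
Qed.

(** Linear choice by Zorn: a linear relation [R] that is a partial function
    extends to a linear map all of whose values obey the total linear
    constraint [M]. Taking [M] trivial extends linear maps from subspaces;
    taking [R] trivial lifts linear maps through surjections. *)
Lemma linear_selection (R M : V -> W -> Prop) :
  linear_relation R -> linear_relation M ->
  (forall x a, R x a -> M x a) -> (forall x, exists a, M x a) ->
  (forall a, R 0 a -> a = 0) ->
  exists f : {linear V -> W},
    (forall x, M x (f x)) /\ (forall x a, R x a -> f x = a).
Proof.
move=> RL ML RM Mtot Rfun.
pose plus (S : V * W -> Prop) x a := S (x, a) \/ R x a.
pose good (Q : V -> W -> Prop) := [/\ linear_relation Q,
  forall x a, Q x a -> M x a & forall a, Q 0 a -> a = 0].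
have [F FP chF|S [[SL SM Sfun] Smax]] :=
    @classical_sets.Zorn_bigcup (V * W)%type (fun S => good (plus S)).
  (* Any two pairs in the union of a chain lie in one of its members, so the
     union is again good. *)
  have two x a y b : plus (classical_sets.bigcup F id) x a ->
      plus (classical_sets.bigcup F id) y b ->
      (R x a /\ R y b) \/ exists2 S, F S & plus S x a /\ plus S y b.
    move=> [[S FS Sxa]|Rxa] [[T FT Tyb]|Ryb].
    - have [ST|TS] := chF _ _ FS FT; right.
        by exists T => //; split; left => //; apply: ST.
      by exists S => //; split; left => //; apply: TS.
    - by right; exists S => //; split; [left|right].
    - by right; exists T => //; split; [right|left].
    - by left.
  have one x a : plus (classical_sets.bigcup F id) x a ->
      R x a \/ exists2 S, F S & plus S x a.
    move=> h; have [[? _]|[S FS [? _]]] := two _ _ _ _ h h; first by left.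
    by right; exists S.
  split.
  - split; first by right; case: RL.
    move=> c x y a b h1 h2; have [[Rx Ry]|[S FS [Sx Sy]]] := two _ _ _ _ h1 h2.
      by right; apply: RL.2.
    have [SL _ _] := FP _ FS; have [Sxy|] := SL.2 c _ _ _ _ Sx Sy.
      by left; exists S.
    by right.
  - by move=> x a /one[/RM//|[S FS Sxa]]; have [_ SM _] := FP _ FS; apply: SM.
  - by move=> a /one[/Rfun//|[S FS Sxa]]; have [_ _ Sf] := FP _ FS; apply: Sf.
have Stot x0 : exists a, plus S x0 a.
  apply: contrapT => nx0; have [a0 Ma0] := Mtot x0.
  (* The relation extended by the pair [(x0, a0)] contradicts maximality. *)
  pose Q x a := exists c y b, [/\ plus S y b, x = y + c *: x0 & a = b + c *: a0].
  have SQ x a : plus S x a -> Q x a.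
    by move=> Sxa; exists 0, x, a; rewrite !scale0r !addr0.
  have QE x a : plus (fun p => Q p.1 p.2) x a -> Q x a.
    by case=> [//|Rxa]; apply: SQ; right.
  apply: (Smax (fun p => Q p.1 p.2)).
    split; last first.
      move=> h; have Qx0 : Q x0 a0.
        by exists 1, 0, 0; rewrite !scale1r !add0r; split=> //; case: SL.
      by apply: nx0; exists a0; left; apply: (h (x0, a0)).
    by move=> [x a] Sxa; apply: SQ; left.
  split.
  - split; first by right; case: RL.
    move=> c x y a b /QE[d [x' [a' [h1 -> ->]]]] /QE[e [y' [b' [h2 -> ->]]]].
    left => /=; exists (c * d + e), (c *: x' + y'), (c *: a' + b').
    split; first exact: SL.2.
      by rewrite scalerDr scalerDl !scalerA addrACA.
    by rewrite scalerDr scalerDl !scalerA addrACA.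
  - move=> x a /QE[c [y [b [/SM h -> ->]]]].
    by rewrite addrC [b + _]addrC; apply: ML.2.
  - move=> a /QE[c [y [b [h /esym/eqP]]]]; rewrite addr_eq0 => /eqP yE ->.
    have [c0|c0] := eqVneq c 0.
      by rewrite c0 scale0r addr0; apply: Sfun; rewrite yE c0 scale0r oppr0 in h.
    case: nx0; exists (- c^-1 *: b).
    have -> : x0 = - c^-1 *: y by rewrite yE scalerN scaleNr opprK scalerK.
    exact: linear_relationZ.
have Sfunc x a b : plus S x a -> plus S x b -> a = b.
  move=> h1 h2; apply/eqP; rewrite -subr_eq0; apply/eqP/Sfun.
  by rewrite -(subrr x); apply: linear_relationD => //; apply: linear_relationN.
pose f x := sval (cid (Stot x)).
have fP x : plus S x (f x) by exact: svalP (cid (Stot x)).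
have fL : linear f by move=> c x y; apply: Sfunc (fP _) _; apply: SL.2.
exists (linear_of fL); split=> [x|x a Rxa]; first by apply: SM; apply: fP.
by apply: (Sfunc x); [apply: fP | right].
Qed.

End LinearMaps.

Section Products.
Local Open Scope ring_scope.
Variables (k : fieldType) (I : Type) (V : I -> lmodType k).

Definition iprod := forall i, V i.

HB.instance Definition _ := gen_eqMixin iprod.
HB.instance Definition _ := gen_choiceMixin iprod.

Implicit Types f g h : iprod.

Definition iprod_add f g : iprod := fun i => f i + g i.
Definition iprod_opp f : iprod := fun i => - f i.
Definition iprod_zero : iprod := fun i => 0.
Definition iprod_scale (c : k) f : iprod := fun i => c *: f i.

Lemma iprodP f g : (forall i, f i = g i) -> f = g.
Proof. exact: functional_extensionality_dep. Qed.

Lemma iprod_addA : associative iprod_add.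
Proof. by move=> f g h; apply: iprodP => i; apply: addrA. Qed.
Lemma iprod_addC : commutative iprod_add.
Proof. by move=> f g; apply: iprodP => i; apply: addrC. Qed.
Lemma iprod_add0 : left_id iprod_zero iprod_add.
Proof. by move=> f; apply: iprodP => i; apply: add0r. Qed.
Lemma iprod_addN : left_inverse iprod_zero iprod_opp iprod_add.
Proof. by move=> f; apply: iprodP => i; apply: addNr. Qed.
HB.instance Definition _ :=
  GRing.isZmodule.Build iprod iprod_addA iprod_addC iprod_add0 iprod_addN.

Lemma iprod_scaleA a b f :
  iprod_scale a (iprod_scale b f) = iprod_scale (a * b) f.
Proof. by apply: iprodP => i; apply: scalerA. Qed.
Lemma iprod_scale1 : left_id 1 iprod_scale.
Proof. by move=> f; apply: iprodP => i; apply: scale1r. Qed.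
Lemma iprod_scaleDr : right_distributive iprod_scale +%R.
Proof. by move=> a f g; apply: iprodP => i; apply: scalerDr. Qed.
Lemma iprod_scaleDl f : {morph iprod_scale^~ f : a b / a + b}.
Proof. by move=> a b; apply: iprodP => i; apply: scalerDl. Qed.
HB.instance Definition _ := GRing.Zmodule_isLmodule.Build k iprod
  iprod_scaleA iprod_scale1 iprod_scaleDr iprod_scaleDl.

Lemma iprodDE f g i : (f + g) i = f i + g i. Proof. by []. Qed.
Lemma iprodZE c f i : (c *: f) i = c *: f i. Proof. by []. Qed.
Lemma iprod0E i : (0 : iprod) i = 0. Proof. by []. Qed.

Definition single i (v : V i) : iprod := fun j =>
  match pselect (i = j) with
  | left e => eq_rect i (fun j => V j) v j e
  | right _ => 0
  end.

Lemma singleE i (v : V i) : single v i = v.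
Proof.
by rewrite /single; case: pselect => // e; rewrite (Prop_irrelevance e erefl).
Qed.

Lemma single_neq i j (v : V i) : i <> j -> single v j = 0.
Proof. by rewrite /single; case: pselect. Qed.

Lemma single_linear i : linear (@single i).
Proof.
move=> c u v; apply: iprodP => j; rewrite iprodDE iprodZE.
have [e|ne] := pselect (i = j); first by case: _ / e; rewrite !singleE.
by rewrite !single_neq // scaler0 addr0.
Qed.

End Products.

Local Open Scope group_scope.

(** * Surjective homomorphisms and generating tuples *)

Section Epimorphisms.
Implicit Types Q R S T G : finGroupType.

(** Honest homomorphisms rather than conjugacy classes: compatibility with
    inner automorphisms is automatic later, since they are composites with
    surjections too. *)
Definition epi S T := {f : {ffun S -> T} | is_surjhom f}.

Definition epi_fun S T (f : epi S T) : S -> T := fun_of_fin (val f).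
Coercion epi_fun : epi >-> Funclass.

Lemma epiM S T (f : epi S T) : {morph f : x y / x * y}.
Proof. by case/is_surjhomP: (valP f). Qed.

Lemma epi_surj S T (f : epi S T) z : exists x, f x = z.
Proof. by have /is_surjhomP[_] := valP f; apply. Qed.

Lemma epi1 S T (f : epi S T) : f 1 = 1.
Proof. by apply: (mulgI (f 1)); rewrite -epiM !mulg1. Qed.

Lemma epiV S T (f : epi S T) x : f x^-1 = (f x)^-1.
Proof. by apply: (mulgI (f x)); rewrite -epiM !mulgV epi1. Qed.

Lemma epi_eqP S T (f g : epi S T) : f =1 g -> f = g.
Proof. by move=> fg; apply/val_inj/ffunP. Qed.

Lemma make_epi_proof S T (f : S -> T) :
  {morph f : x y / x * y} -> (forall z, exists x, f x = z) ->
  is_surjhom (finfun f).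
Proof.
move=> fM fS; apply/is_surjhomP; split=> [x y|z]; first by rewrite !ffunE fM.
by have [x <-] := fS z; exists x; rewrite ffunE.
Qed.

Definition make_epi S T (f : S -> T) (fM : {morph f : x y / x * y})
    (fS : forall z, exists x, f x = z) : epi S T :=
  exist (fun f => is_surjhom f) _ (make_epi_proof fM fS).

Lemma make_epiE S T (f : S -> T) fM fS : @make_epi S T f fM fS =1 f.
Proof. by move=> x; rewrite /epi_fun /= ffunE. Qed.

Definition epi_id T : epi T T :=
  exist (fun f => is_surjhom f) _ (is_surjhom_id T).

Lemma epi_idE T x : epi_id T x = x.
Proof. by rewrite /epi_fun /= ffunE. Qed.

Definition epi_comp R S T (f : epi S T) (e : epi R S) : epi R T :=
  exist (fun f => is_surjhom f) _ (is_surjhom_comp (valP f) (valP e)).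

Lemma epi_compE R S T (f : epi S T) (e : epi R S) x :
  epi_comp f e x = f (e x).
Proof. by rewrite /epi_fun /= ffunE. Qed.

Lemma epi_compA Q R S T (h : epi S T) (g : epi R S) (f : epi Q R) :
  epi_comp h (epi_comp g f) = epi_comp (epi_comp h g) f.
Proof. by apply: epi_eqP => x; rewrite !epi_compE. Qed.

Lemma epi_comp1 S T (f : epi S T) : epi_comp (epi_id T) f = f.
Proof. by apply: epi_eqP => x; rewrite epi_compE epi_idE. Qed.

Lemma epi_cancel R S T (f g : epi S T) (e : epi R S) :
  epi_comp f e = epi_comp g e -> f = g.
Proof.
move=> fg; apply: epi_eqP => y; have [x <-] := epi_surj e y.
by rewrite -!epi_compE fg.
Qed.

Definition epi_conj S T (f : epi S T) (h : T) : epi S T.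
Proof.
apply: (@make_epi S T (fun x => f x ^ h)) => [x y|z]; first by rewrite epiM conjMg.
by have [x fx] := epi_surj f (z ^ h^-1); exists x; rewrite fx conjgKV.
Defined.

Lemma epi_conjE S T (f : epi S T) h x : epi_conj f h x = f x ^ h.
Proof. exact: make_epiE. Qed.

Lemma epi_factor R S T (e : epi R S) (g : epi R T) :
  (forall x, e x = 1 -> g x = 1) -> exists f : epi S T, epi_comp f e = g.
Proof.
move=> eg.
have E x y : e x = e y -> g x = g y.
  move=> exy; apply/eqP; rewrite eq_mulgV1 -epiV -epiM; apply/eqP/eg.
  by rewrite epiM epiV exy mulgV.
pose s y := sval (cid (epi_surj e y)).
have sK y : e (s y) = y by apply: svalP (cid (epi_surj e y)).
have fM : {morph (fun y => g (s y)) : x y / x * y}.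
  by move=> x y; rewrite -epiM; apply: E; rewrite epiM !sK.
have fS z : exists y, g (s y) = z.
  by have [x <-] := epi_surj g z; exists (e x); apply: E; rewrite sK.
exists (make_epi fM fS); apply: epi_eqP => x.
by rewrite epi_compE make_epiE; apply: E; rewrite sK.
Qed.

Lemma epi_inverse S T (f : epi S T) : injective f ->
  exists g : epi T S, epi_comp f g = epi_id T /\ epi_comp g f = epi_id S.
Proof.
move=> finj; have [|g gf] := @epi_factor _ _ _ f (epi_id S).
  by move=> x fx; rewrite epi_idE; apply: finj; rewrite fx epi1.
exists g; split=> //; apply: (@epi_cancel _ _ _ _ _ f); apply: epi_eqP => x.
by rewrite !epi_compE epi_idE -(epi_compE g f) gf epi_idE.
Qed.

Definition epi_morphism S T (f : epi S T) : {morphism [set: S] >-> T} :=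
  Morphism (in2W (epiM f)).

Lemma leq_card_epi S T : epi S T -> (#|T| <= #|S|)%N.
Proof.
move=> f; rewrite -!cardsT -(_ : f @: [set: S] = [set: T]) ?leq_imset_card //.
by apply/setP => y; rewrite inE; have [x <-] := epi_surj f y; rewrite imset_f.
Qed.

Lemma morph_onto_gen S T (f : S -> T) (A : {set T}) :
  {morph f : x y / x * y} -> <<A>> = [set: T] ->
  (forall y, y \in A -> exists x, f x = y) -> forall z, exists x, f x = z.
Proof.
move=> fM gA Af z; pose F : {morphism [set: S] >-> T} := Morphism (in2W fM).
have : z \in F @* [set: S].
  have /subsetP : <<A>> \subset F @* [set: S].
    rewrite gen_subG; apply/subsetP => y /Af[x <-].
    by apply: (mem_morphim F); rewrite inE.
  by apply; rewrite gA inE.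
by case/morphimP => x _ _ ->; exists x.
Qed.

End Epimorphisms.

Section GeneratingTuples.
Variable n : nat.
Implicit Types S T : finGroupType.

Definition tuple_group T (t : {ffun 'I_n -> T}) : {group T} :=
  <<[set t i | i in 'I_n]>>%G.

Definition generating T (t : {ffun 'I_n -> T}) : bool :=
  tuple_group t == [set: T] :> {set T}.

Definition push S T (f : S -> T) (s : {ffun 'I_n -> S}) : {ffun 'I_n -> T} :=
  [ffun i => f (s i)].

Lemma tuple_group_push S T (f : epi S T) s :
  tuple_group (push f s) = f @: tuple_group s :> {set T}.
Proof.
have := morphim_gen (epi_morphism f) (subsetT [set s i | i in 'I_n]).
rewrite /= !morphimEsub ?subsetT // => ->.
rewrite -imset_comp; congr <<_>>; apply: eq_imset => i /=; rewrite ffunE //.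
Qed.

Lemma generating_push S T (f : epi S T) s : generating s -> generating (push f s).
Proof.
move=> /eqP gs; rewrite /generating tuple_group_push gs; apply/eqP/setP => y.
by rewrite !inE; have [x <-] := epi_surj f y; rewrite imset_f.
Qed.

Lemma generating_exists T : (#|T| <= n)%N -> exists t : {ffun 'I_n -> T}, generating t.
Proof.
move=> Tn; exists [ffun i : 'I_n => nth 1 (enum T) i]; apply/eqP/setP => x.
rewrite inE; apply/mem_gen/imsetP.
have xn : (index x (enum T) < n)%N.
  by apply: leq_trans Tn; rewrite cardE index_mem mem_enum.
by exists (Ordinal xn) => //; rewrite ffunE nth_index ?mem_enum.
Qed.

Lemma epi_eq_generating S T (f g : epi S T) s :
  generating s -> push f s = push g s -> f = g.
Proof.
move=> /eqP gs /ffunP fg; apply: epi_eqP => x.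
have : [set: S] \subset [set x | f x == g x].
  have fgG : group_set [set x | f x == g x].
    apply/group_setP; split=> [|y z]; first by rewrite inE !epi1.
    by rewrite !inE !epiM => /eqP-> /eqP->.
  rewrite -gs (_ : [set x | f x == g x] = Group fgG) // gen_subG.
  apply/subsetP => _ /imsetP[i _ ->].
  by have := fg i; rewrite !inE !ffunE => ->.
by move/subsetP/(_ x (in_setT _)); rewrite inE => /eqP.
Qed.

Section Gaschutz.
Variables (S T : finGroupType) (f : epi S T).

Definition lifts (C : {group S}) t : {set {ffun 'I_n -> S}} :=
  [set s | (tuple_group s == C) && (push f s == t)].

(** Multiplying the entries by the quotients of fixed lifts of [t'] and [t] in
    [C] carries the lifts of [t] to those of [t']. *)
Lemma leq_card_tuples_over (C : {group S}) t t' : f @: C = [set: T] ->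
  (#|[set s | (tuple_group s \subset C) && (push f s == t)]| <=
   #|[set s | (tuple_group s \subset C) && (push f s == t')]|)%N.
Proof.
move=> fC.
have lift y : exists x, x \in C /\ f x = y.
  have : y \in f @: C by rewrite fC inE.
  by case/imsetP => x Cx ->; exists x.
pose l y := sval (cid (lift y)).
have lC y : l y \in C by have [] := svalP (cid (lift y)).
have fl y : f (l y) = y by have [] := svalP (cid (lift y)).
have genC (s : {ffun 'I_n -> S}) :
    (tuple_group s \subset C) = [forall i, s i \in C].
  rewrite gen_subG; apply/subsetP/forallP => [h i|h x].
    by apply: h; apply: imset_f.
  by case/imsetP => i _ ->.
pose tr (s : {ffun 'I_n -> S}) := [ffun i => s i * (l (t i))^-1 * l (t' i)].
have tr_inj : injective tr.
  move=> s s' /ffunP e; apply/ffunP => i; move: (e i); rewrite !ffunE.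
  by move=> /mulIg/mulIg.
rewrite -(card_imset _ tr_inj); apply/subset_leq_card/subsetP => u /imsetP[s].
rewrite inE genC => /andP[/forallP sC /eqP ps] ->; rewrite inE genC.
apply/andP; split; first by apply/forallP => i; rewrite ffunE !groupM ?groupV.
apply/eqP/ffunP => i; rewrite !ffunE !epiM epiV !fl -ps ffunE mulgV mul1g.
by [].
Qed.

Lemma card_tuples_over (C : {group S}) t :
  generating t ->
  #|[set s | (tuple_group s \subset C) && (push f s == t)]| =
  (\sum_(B : {group S} | (B \subset C) && (f @: B == [set: T])) #|lifts B t|)%N.
Proof.
move=> /eqP gt; rewrite -sum1_card.
rewrite (partition_big (@tuple_group S)
          (fun B => (B \subset C) && (f @: B == [set: T]))) /=; last first.
  move=> s; rewrite inE => /andP[-> /eqP ps] /=.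
  by rewrite -tuple_group_push ps gt.
apply: eq_bigr => B /andP[BC _]; rewrite -sum1_card; apply: eq_bigl => s.
rewrite !inE andbC; case: (tuple_group s =P B) => //= gsB.
by rewrite [<<_>>](congr1 val gsB) BC.
Qed.

(** Induction on [C]: by [leq_card_tuples_over] the number of all lifts with
    entries in [C] does not depend on the tuple, and the lifts that generate a
    proper subgroup are counted by the induction hypothesis. *)
Lemma gaschutz (C : {group S}) t t' :
  f @: C = [set: T] -> generating t -> generating t' ->
  #|lifts C t| = #|lifts C t'|.
Proof.
move=> + gt gt'; have [m] := ubnP #|C|; elim: m C => // m IHm C Cm fC.
have : #|[set s | (tuple_group s \subset C) && (push f s == t)]| =
       #|[set s | (tuple_group s \subset C) && (push f s == t')]|.
  by apply/eqP; rewrite eqn_leq !leq_card_tuples_over.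
have split_off u : generating u ->
    #|[set s | (tuple_group s \subset C) && (push f s == u)]| =
    (#|lifts C u| + \sum_(B : {group S} |
       [&& B \subset C, f @: B == [set: T] & B != C]) #|lifts B u|)%N.
  move=> gu; rewrite card_tuples_over // (bigD1 C) ?subxx ?fC ?eqxx //=.
  by congr (_ + _)%N; apply: eq_bigl => B; rewrite andbA.
rewrite !split_off //.
have -> : (\sum_(B : {group S} | [&& B \subset C, f @: B == [set: T] & B != C])
    #|lifts B t| = \sum_(B : {group S} |
    [&& B \subset C, f @: B == [set: T] & B != C]) #|lifts B t'|)%N.
  apply: eq_bigr => B /and3P[BC /eqP fB neB]; apply: IHm => //.
  apply: leq_trans (_ : #|C| <= m)%N => //; apply: proper_card.
  by rewrite properEneq BC andbT.
by move/addIn.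
Qed.

(** Gaschuetz's lemma, in its counting form. *)
Lemma card_generating_lifts t t' : generating t -> generating t' ->
  #|[set s : {ffun 'I_n -> S} | generating s && (push f s == t)]| =
  #|[set s : {ffun 'I_n -> S} | generating s && (push f s == t')]|.
Proof.
move=> gt gt'.
have -> u : [set s : {ffun 'I_n -> S} | generating s && (push f s == u)]
            = lifts [set: S]%G u.
  by apply/setP => s; rewrite !inE.
apply: gaschutz => //; apply/setP => y.
by rewrite inE; have [x <-] := epi_surj f y; rewrite imset_f ?inE.
Qed.

End Gaschutz.
End GeneratingTuples.

(** * Roofs and homogeneous covers in the family *)

HB.instance Definition _ (S T : finGroupType) :=
  Finite.copy (epi S T) {f : {ffun S -> T} | is_surjhom f}.

Section Families.
Variable U : FinGrp -> Prop.
Hypotheses (U_replete : replete U) (U_multiplicative : multiplicative_family U)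
  (U_global : global_family U).

Definition member : Type := {G : finGroupType | U G}.
Definition member_group (G : member) : finGroupType := sval G.
Coercion member_group : member >-> FinGroup.type.

Lemma U_prod (S T : member) : U (S * T)%type.
Proof. by apply: U_multiplicative.2; apply: svalP. Qed.

Lemma U_subg (G : finGroupType) (H : {group G}) : U G -> U (subg_of H).
Proof. exact: U_global.1. Qed.

Lemma isomorphic_epi (S T : finGroupType) (f : epi S T) : injective f ->
  isomorphic (S : FinGrp) T.
Proof.
move=> /epi_inverse[g [fg gf]].
exists (class_of (valP f)), (class_of (valP g)); split;
  rewrite /= group_comp_class; apply: class_of_eq.
  exact: (congr1 val gf).
exact: (congr1 val fg).
Qed.

Lemma quotient_epi (G : finGroupType) (N : {group G}) : N <| [set: G] ->
  exists q : epi G (coset_of N), forall x, (q x == 1) = (x \in N).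
Proof.
move=> nN; have nNx x : x \in 'N(N).
  by have /subsetP := normal_norm nN; apply; rewrite inE.
have qM : {morph coset N : x y / x * y} by move=> x y; rewrite morphM.
have qS z : exists x, coset N x = z by have [x _ ->] := cosetP z; exists x.
exists (make_epi qM qS) => x; rewrite make_epiE.
by apply/eqP/idP => [/coset_idr->|/coset_id].
Qed.

Lemma kernel_epi (G Q : finGroupType) (r : epi G Q) :
  exists2 N : {group G}, N <| [set: G] & forall x, (x \in N) = (r x == 1).
Proof.
exists ('ker (epi_morphism r))%G; first exact: ker_normal.
by move=> x; apply/idP/eqP => [/mker //|rx]; apply/kerP; rewrite ?inE.
Qed.

(** The family is given to be closed under quotients by normal subgroups; by
    the first isomorphism theorem and repleteness it contains all images. *)
Lemma U_epi (G : member) (Q : finGroupType) (r : epi G Q) : U Q.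
Proof.
have [N nN Nr] := kernel_epi r; have [q qN] := quotient_epi nN.
have [|f fq] := @epi_factor _ _ _ q r.
  by move=> x /eqP; rewrite qN Nr => /eqP.
apply: (U_replete (x := coset_of N : FinGrp)); last exact: U_global.2 (svalP G).
apply: (@isomorphic_epi _ _ f) => x y.
have [{}x <-] := epi_surj q x; have [{}y <-] := epi_surj q y.
rewrite -!epi_compE fq => /eqP; rewrite eq_mulgV1 -epiV -epiM -Nr -qN.
by rewrite epiM epiV -eq_mulgV1 => /eqP.
Qed.

(** A roof stands for the subgroup of pairs [(left_leg w, right_leg w)] of
    [T * G], which [legs] describes. The representation by a group with two
    surjections avoids conditions on subgroups of the product, and only [legs]
    matters for cocones ([at_roof_eq]). *)
Record roof (T G : member) := Roof
  { apex : member; left_leg : epi apex T; right_leg : epi apex G }.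

Definition legs T G (s : roof T G) (t : T) (g : G) : Prop :=
  exists w, left_leg s w = t /\ right_leg s w = g.

Lemma roof_of_group (T G : member) (W : {group T * G}) :
  (forall t, exists g, (t, g) \in W) -> (forall g, exists t, (t, g) \in W) ->
  exists s : roof T G, injective (fun w => (left_leg s w, right_leg s w)) /\
    forall t g, legs s t g <-> (t, g) \in W.
Proof.
move=> WT WG; pose A : member := exist U _ (U_subg W (U_prod T G)).
have p1M : {morph (fun w : A => (sgval w).1) : x y / x * y} by [].
have p2M : {morph (fun w : A => (sgval w).2) : x y / x * y} by [].
have p1S t : exists w : A, (sgval w).1 = t.
  by have [g Wtg] := WT t; exists (Subg Wtg).
have p2S g : exists w : A, (sgval w).2 = g.
  by have [t Wtg] := WG g; exists (Subg Wtg).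
exists (@Roof _ _ A (make_epi p1M p1S) (make_epi p2M p2S)); split.
  move=> v w /=; rewrite !make_epiE -!surjective_pairing; exact: subg_inj.
move=> t g; split.
  by case=> w /=; rewrite !make_epiE => -[<- <-]; rewrite -surjective_pairing subgP.
by move=> Wtg; exists (Subg Wtg); rewrite /= !make_epiE.
Qed.

Lemma roof_factor (T G S : member) (a : epi S T) (b : epi S G) (s : roof T G) :
  injective (fun w => (left_leg s w, right_leg s w)) ->
  (forall t g, legs s t g <-> exists x, a x = t /\ b x = g) ->
  exists c : epi S (apex s),
    epi_comp (left_leg s) c = a /\ epi_comp (right_leg s) c = b.
Proof.
move=> sinj sab.
have lift x : exists w, left_leg s w = a x /\ right_leg s w = b x.
  by apply/sab; exists x.
pose c x := sval (cid (lift x)).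
have cP x : left_leg s (c x) = a x /\ right_leg s (c x) = b x.
  exact: svalP (cid (lift x)).
have cM : {morph c : x y / x * y}.
  move=> x y; apply: sinj; rewrite /= !epiM.
  by have [-> ->] := cP x; have [-> ->] := cP y; have [-> ->] := cP (x * y); rewrite !epiM.
have cS w : exists x, c x = w.
  have [|x [ax bx]] := (sab (left_leg s w) (right_leg s w)).1; first by exists w.
  by exists x; apply: sinj; have [-> ->] := cP x; rewrite ax bx.
exists (make_epi cM cS); split; apply: epi_eqP => x; rewrite epi_compE make_epiE;
  by have [] := cP x.
Qed.

Lemma roof_image (T G S : member) (a : epi S T) (b : epi S G) :
  exists s : roof T G, injective (fun w => (left_leg s w, right_leg s w)) /\
    forall t g, legs s t g <-> exists x, a x = t /\ b x = g.
Proof.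
have abM : {morph (fun x : S => (a x, b x)) : x y / x * y}.
  by move=> x y; rewrite !epiM.
pose F : {morphism [set: S] >-> T * G} := Morphism (in2W abM).
have FP t g : (t, g) \in (F @* [set: S])%G <-> exists x, a x = t /\ b x = g.
  split=> [/morphimP[x _ _ [-> ->]]|[x [<- <-]]]; first by exists x.
  by apply: (mem_morphim F); rewrite inE.
have [t|g|s [sinj sP]] := @roof_of_group T G (F @* [set: S])%G.
- by have [x <-] := epi_surj a t; exists (b x); apply/FP; exists x.
- by have [x <-] := epi_surj b g; exists (a x); apply/FP; exists x.
by exists s; split=> // t g; rewrite sP FP.
Qed.

Lemma fiber_product (T G : member) (Q : finGroupType) (f : epi T Q) (r : epi G Q) :
  exists s : roof T G, forall t g, legs s t g <-> f t = r g.
Proof.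
have WG : group_set [set p : T * G | f p.1 == r p.2].
  apply/group_setP; split=> [|[x1 x2] [y1 y2]]; first by rewrite inE !epi1.
  by rewrite !inE /= !epiM => /eqP-> /eqP->.
have [t|g|s [_ sP]] := @roof_of_group T G (Group WG).
- by have [g gt] := epi_surj r (f t); exists g; rewrite inE gt.
- by have [t tg] := epi_surj f (r g); exists t; rewrite inE tg.
by exists s => t g; rewrite sP inE; split=> /eqP.
Qed.

(** The tuple is built by adjoining one [t j] at a time: pair it with the tuple
    already found, and pass to the subgroup generated by the pairs. *)
Lemma universal_tuple n (J : eqType) (T : J -> member)
    (t : forall j, {ffun 'I_n -> T j}) (s : seq J) :
  exists (K : member) (kap : {ffun 'I_n -> K}), generating kap /\
    forall j, j \in s -> generating (t j) ->
      exists gam : epi K (T j), push gam kap = t j.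
Proof.
elim: s => [|j s [K [kap [gkap IH]]]].
  exists (exist U _ U_multiplicative.1), [ffun=> 1]; split=> //.
  apply/eqP/setP => x; rewrite inE.
  by have -> : x = 1; [rewrite [x]ord1 [RHS]ord1 | exact: group1].
have [gt|ngt] := boolP (generating (t j)); last first.
  exists K, kap; split=> // i; rewrite inE => /predU1P[-> gt|/IH//].
  by rewrite gt in ngt.
(* The new group is generated by [w] in [K * T j]. *)
pose w : {ffun 'I_n -> K * T j} := [ffun i => (kap i, t j i)].
have ww i : w i \in tuple_group w by apply/mem_gen/imset_f.
have p1 x : exists y, (x, y) \in tuple_group w.
  have fM : {morph (fun v : subg_of (tuple_group w) => (sgval v).1) : x y / x * y} by [].
  have [|v <-] := morph_onto_gen fM (eqP gkap) _ x.
    by move=> _ /imsetP[i _ ->]; exists (Subg (ww i)); rewrite /= ffunE.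
  by exists (sgval v).2; rewrite -surjective_pairing subgP.
have p2 y : exists x, (x, y) \in tuple_group w.
  have fM : {morph (fun v : subg_of (tuple_group w) => (sgval v).2) : x y / x * y} by [].
  have [|v <-] := morph_onto_gen fM (eqP gt) _ y.
    by move=> _ /imsetP[i _ ->]; exists (Subg (ww i)); rewrite /= ffunE.
  by exists (sgval v).1; rewrite -surjective_pairing subgP.
have [S [Sinj SP]] := roof_of_group p1 p2.
have lift i : exists v, left_leg S v = kap i /\ right_leg S v = t j i.
  by apply/SP; have := ww i; rewrite ffunE.
pose kap' := [ffun i => sval (cid (lift i))].
have kap'1 : push (left_leg S) kap' = kap.
  by apply/ffunP => i; rewrite !ffunE; have [] := svalP (cid (lift i)).
have kap'2 : push (right_leg S) kap' = t j.
  by apply/ffunP => i; rewrite !ffunE; have [] := svalP (cid (lift i)).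
exists (apex S), kap'; split; last first.
  move=> i; rewrite inE => /predU1P[->|/IH{}IH] gti; first by exists (right_leg S).
  have [gam gamK] := IH gti; exists (epi_comp gam (left_leg S)).
  by apply/ffunP => x; rewrite -gamK -kap'1 !ffunE epi_compE.
apply/eqP/setP => v; rewrite inE.
pose pr (v : apex S) := (left_leg S v, right_leg S v).
have prM : {morph pr : x y / x * y} by move=> x y; rewrite /pr !epiM.
pose F : {morphism [set: apex S] >-> K * T j} := Morphism (in2W prM).
have : F v \in F @* tuple_group kap'.
  have -> : F @* tuple_group kap' = tuple_group w.
    rewrite morphim_gen ?subsetT // morphimEsub ?subsetT // -imset_comp.
    congr <<_>>; apply: eq_imset => i; rewrite [RHS]ffunE -kap'1 -kap'2.
    by rewrite [push _ _ i]ffunE [push (right_leg S) _ i]ffunE.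
  by rewrite /= /pr; apply/SP; exists v.
by case/morphimP => u _ uK /Sinj ->.
Qed.

(** The universal tuple identifies the surjections from [K] onto [T j] with the
    generating tuples of [T j], so that Gaschuetz's lemma applies. *)
Lemma homogeneous_cover (J : eqType) (T : J -> member) (s : seq J) :
  exists K : member, (forall j, j \in s -> exists gam : epi K (T j), True) /\
    forall i j (a : epi (T i) (T j)), i \in s -> j \in s ->
    exists2 m, (0 < m)%N & forall gam : epi K (T j),
      #|[set d : epi K (T i) | epi_comp a d == gam]| = m.
Proof.
pose n := (\sum_(j <- s) #|T j|)%N.
have Tn j : j \in s -> (#|T j| <= n)%N.
  by move=> js; rewrite /n (big_rem j) //= leq_addr.
pose J' := {j : J & {ffun 'I_n -> T j}}.
have [K [kap [gkap Kuniv]]] := @universal_tuple n J' (fun x => T (tag x))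
  (fun x => tagged x)
  [seq Tagged (fun j => {ffun 'I_n -> T j}) u
     | j <- s, u <- enum {ffun 'I_n -> T j}].
have {}Kuniv j (t : {ffun 'I_n -> T j}) : j \in s -> generating t ->
    exists gam : epi K (T j), push gam kap = t.
  move=> js gt; apply: (Kuniv (Tagged _ t)) => //.
  by apply/allpairsPdep; exists j, t; rewrite mem_enum.
exists K; split=> [j js|i j a is_ js].
  by have [t gt] := generating_exists (Tn j js); have [gam _] := Kuniv j t js gt; exists gam.
have cardE (gam : epi K (T j)) : #|[set d : epi K (T i) | epi_comp a d == gam]| =
    #|[set u : {ffun 'I_n -> T i} | generating u && (push a u == push gam kap)]|.
  pose ev (d : epi K (T i)) := push d kap.
  have evinj : injective ev by move=> d d'; apply: epi_eq_generating.
  have pushE (d : epi K (T i)) : push a (push d kap) = push (epi_comp a d) kap.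
    by apply/ffunP => x; rewrite !ffunE epi_compE.
  rewrite -(card_imset _ evinj); apply: eq_card => u; rewrite [in RHS]inE.
  apply/imsetP/andP => [[d]|[gu /eqP au]].
    rewrite inE => /eqP dg ->; rewrite generating_push //; split=> //.
    by rewrite pushE dg.
  have [d du] := Kuniv i u is_ gu; exists d => //; rewrite inE; apply/eqP.
  by apply: (epi_eq_generating gkap); rewrite -pushE du.
have [u0 gu0] := generating_exists (Tn i is_).
exists #|[set u : {ffun 'I_n -> T i} | generating u && (push a u == push a u0)]|.
  by apply/card_gt0P; exists u0; rewrite inE gu0 /=.
move=> gam; rewrite cardE; apply: card_generating_lifts; exact: generating_push.
Qed.

End Families.

(** * Models of the groups in the family, and cocones *)

Section Models.
Variable U : FinGrp -> Prop.

(** By Cayley's theorem, subgroups of symmetric groups represent all finite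
    groups. They form a set, over which products of vector spaces can be taken;
    fixing the degree to be the order leaves finitely many of each order. *)
Definition perm_model : Type := {x : {n : nat & {group 'S_n}} |
  (#|tagged x| == tag x) && `[< U (subg_of (tagged x)) >]}.

Definition perm_model_group (i : perm_model) : member U :=
  exist U (subg_of (tagged (sval i))) (asboolW (proj2 (andP (svalP i)))).

Lemma perm_model_cover (T : member U) : replete U ->
  exists (i : perm_model) (f : epi T (perm_model_group i)) (g : epi (perm_model_group i) T),
    epi_comp f g = epi_id _ /\ epi_comp g f = epi_id _.
Proof.
move=> U_replete.
(* The Cayley representation, with [T] renumbered by [enum_rank]. *)
pose c (x : T) (j : 'I_#|T|) := enum_rank (enum_val j * x).
have c_inj x : injective (c x).
  by move=> i j /enum_rank_inj/mulIg/enum_val_inj.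
pose p x : 'S_#|T| := perm (@c_inj x).
have pM : {morph p : x y / x * y}.
  by move=> x y; apply/permP => j; rewrite permM !permE /c enum_rankK mulgA.
have p_inj : injective p.
  move=> x y /permP/(_ (enum_rank 1)); rewrite !permE /c => /enum_rank_inj.
  by rewrite enum_rankK !mul1g.
pose P : {morphism [set: T] >-> 'S_#|T|} := Morphism (in2W pM).
pose H := (P @* [set: T])%G.
have pH x : p x \in H by apply: (mem_morphim P); rewrite inE.
have fM : {morph (fun x => Subg (pH x)) : x y / x * y}.
  by move=> x y; apply: val_inj; rewrite /= pM.
have fS z : exists x, Subg (pH x) = z.
  case: z => z zH; have /morphimP[x _ _ zE] := zH.
  by exists x; apply: val_inj; rewrite /= zE.
pose f0 : epi T (subg_of H) := make_epi fM fS.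
have f0_inj : injective f0.
  by move=> x y; rewrite !make_epiE => /(congr1 val)/p_inj.
have ok : (#|H| == #|T|) && `[< U (subg_of H) >].
  apply/andP; split.
    rewrite card_injm ?cardsT //.
    by apply/injmP => x y _ _; apply: p_inj.
  apply/asboolP; apply: (U_replete (T : finGroupType) _ _ (svalP T)).
  exact: isomorphic_epi f0_inj.
pose i : perm_model := exist _ (Tagged (fun n => {group 'S_n}) H) ok.
have [g [fg gf]] := epi_inverse (f0_inj : injective (f0 : epi T (perm_model_group i))).
by exists i, f0, g.
Qed.

Lemma finitely_many_perm_models (T : member U) :
  exists s : seq perm_model, uniq s /\ forall i, epi T (perm_model_group i) -> i \in s.
Proof.
pose r := [seq Tagged (fun n => {group 'S_n}) H | n <- iota 0 #|T|.+1,
                                       H <- enum {: {group 'S_n}}].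
have in_iota m n : (m <= n)%N -> m \in iota 0 n.+1.
  by move=> mn; rewrite mem_iota add0n ltnS.
exists (undup (pmap insub r)); split=> [|i f]; first exact: undup_uniq.
have iT : (tag (sval i) <= #|T|)%N.
  apply: leq_trans (leq_card_epi f); have /andP[iE _] := svalP i.
  by rewrite card_sub (eqP iE).
rewrite mem_undup mem_pmap_sub; apply/allpairsPdep.
exists (tag (val i)), (tagged (val i)).
by split; [apply: in_iota | rewrite mem_enum | case: (val i)].
Qed.



(** The properties of the representatives that are used below, stated once so
    that their construction remains hidden. *)
Lemma model_system : {M : eqType & {gr : M -> member U |
  (replete U -> forall T : member U,
    exists (i : M) (f : epi T (gr i)) (g : epi (gr i) T),
      epi_comp f g = epi_id _ /\ epi_comp g f = epi_id _) /\
  forall T : member U,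
    exists s : seq M, uniq s /\ forall i, epi T (gr i) -> i \in s}}.
Proof.
exists (perm_model : eqType), perm_model_group; split.
  by move=> rU T; exact: perm_model_cover.
exact: finitely_many_perm_models.
Qed.

Definition model : eqType := projT1 model_system.
Definition model_group : model -> member U := sval (projT2 model_system).

Lemma model_cover (T : member U) : replete U ->
  exists (i : model) (f : epi T (model_group i)) (g : epi (model_group i) T),
    epi_comp f g = epi_id _ /\ epi_comp g f = epi_id _.
Proof. by move=> rU; have [/(_ rU T)] := svalP (projT2 model_system). Qed.

Lemma finitely_many_models (T : member U) :
  exists s : seq model, uniq s /\ forall i, epi T (model_group i) -> i \in s.
Proof. by have [_ /(_ T)] := svalP (projT2 model_system). Qed.

End Models.

Section Cocones.
Variables (k : fieldType) (U : FinGrp -> Prop).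
Hypothesis k_char0 : [pchar k]%R =i pred0.
Hypotheses (U_replete : replete U) (U_multiplicative : multiplicative_family U)
  (U_global : global_family U).
Local Open Scope ring_scope.

Definition value (X : AU U k) (T : member U) : lmodType k := fobj X T.

Definition pull (X : AU U k) (S T : member U) (f : epi S T) :
    {linear value X T -> value X S} :=
  @fmap _ _ X T S (class_of (valP f)).

Variable X : AU U k.

Lemma pull_id (T : member U) (x : value X T) : pull X (epi_id T) x = x.
Proof.
rewrite /pull (class_of_eq (valP (epi_id T)) (is_surjhom_id T)) //.
by rewrite [@fmap _ _ X T T _](fmap_id X T).
Qed.

Lemma pull_comp (R S T : member U) (f : epi S T) (e : epi R S) (x : value X T) :
  pull X (epi_comp f e) x = pull X e (pull X f x).
Proof.
rewrite /pull (class_of_eq (valP (epi_comp f e))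
   (is_surjhom_comp (valP f) (valP e))) // -group_comp_class.
have := @fmap_comp _ _ X T S R (class_of (valP e)) (class_of (valP f)).
by move=> /= E; rewrite [@fmap _ _ X _ _ _]E.
Qed.

Definition average (K T G : member U) (g : epi K G) (f : epi T G) (x : value X T) :
    value X K :=
  (#|[set d : epi K T | epi_comp f d == g]|%:R : k)^-1 *:
    \sum_(d : epi K T | epi_comp f d == g) pull X d x.

Lemma average_linear (K T G : member U) (g : epi K G) (f : epi T G) :
  linear (average g f).
Proof.
move=> c x y; rewrite /average scalerA mulrC -scalerA -scalerDr; congr (_ *: _).
by rewrite scaler_sumr -big_split; apply: eq_bigr => d _; rewrite linearP.
Qed.

Lemma natr_neq0 n : (0 < n)%N -> (n%:R : k) != 0.
Proof. by move=> n0; rewrite ((pcharf0P k).1 k_char0) -lt0n. Qed.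

(** Composition with [a] maps the surjections from [K] over [G] to one another
    with fibres of constant size, so a mean over the source is a mean over the
    target. *)
Lemma average_pull (J : eqType) (T : J -> member U) (G : member U)
    (f : forall j, epi (T j) G) (s : seq J) :
  exists (K : member U) (g : epi K G),
    (forall j, j \in s -> (0 < #|[set d : epi K (T j) | epi_comp (f j) d == g]|)%N)
    /\ forall i j (a : epi (T i) (T j)) x, i \in s -> j \in s ->
      epi_comp (f j) a = f i -> average g (f i) (pull X a x) = average g (f j) x.
Proof.
(* [None] stands for [G] itself, whose surjections from [K] index the slices. *)
pose T' (j : option J) := if j is Some j then T j else G.
have [K [Kn Kh]] := homogeneous_cover U_multiplicative U_global T'
  (None :: map Some s).
have [g _] := Kn None (mem_head _ _).
have mem j : j \in s -> Some j \in None :: map Some s.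
  by move=> js; rewrite inE mem_map // => ? ? [].
have pos j : j \in s ->
    (0 < #|[set d : epi K (T j) | epi_comp (f j) d == g]|)%N.
  move=> js; have [m m0 mE] := Kh (Some j) None (f j) (mem j js) (mem_head _ _).
  by rewrite (mE g).
exists K, g; split=> // i j a x is_ js fE.
have [m m0 mE] := Kh (Some i) (Some j) a (mem i is_) (mem j js).
rewrite /= in mE; rewrite /average.
have part (M : nmodType) (F : epi K (T i) -> M) :
    (\sum_(d : epi K (T i) | epi_comp (f i) d == g) F d =
     \sum_(e : epi K (T j) | epi_comp (f j) e == g)
       \sum_(d : epi K (T i) | epi_comp a d == e) F d).
  rewrite (partition_big (fun d => epi_comp a d)
             (fun e => epi_comp (f j) e == g)) /=; last first.
    by move=> d /eqP <-; apply/eqP/epi_eqP => y; rewrite -fE !epi_compE.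
  apply: eq_bigr => e /eqP eg; apply: eq_bigl => d.
  apply/andP/idP => [[] // | /eqP de]; split; last exact/eqP.
  by rewrite -eg -de -fE; apply/eqP/epi_eqP => y; rewrite !epi_compE.
have cardE : #|[set d : epi K (T i) | epi_comp (f i) d == g]| =
    (#|[set d : epi K (T j) | epi_comp (f j) d == g]| * m)%N.
  rewrite -sum1_card (eq_bigl (fun d => epi_comp (f i) d == g)); last first.
    by move=> d; rewrite inE.
  rewrite (part nat) -sum_nat_const; apply: eq_big => [e|e _]; first by rewrite inE.
  by rewrite sum1dep_card -(mE e).
rewrite cardE natrM invfM -scalerA; congr (_ *: _).
rewrite part scaler_sumr; apply: eq_bigr => e _.
rewrite (eq_bigr (fun _ => pull X e x)); last first.
  by move=> d /eqP <-; rewrite pull_comp.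
by rewrite sumr_const -cardsE mE -scaler_nat scalerA mulVf ?scale1r ?natr_neq0.
Qed.

Section Values.
Variables (G : member U) (V : lmodType k).

(** A cocone under the functor that sends [f : T -> G] to [X T], that is, a
    linear map to [V] from the colimit of [X] over the slice category of [G]. *)
Definition cocone (psi : forall T : member U, epi T G -> value X T -> V) : Prop :=
  (forall T f, linear (psi T f)) /\
  forall (S T : member U) (a : epi S T) f x,
    psi S (epi_comp f a) (pull X a x) = psi T f x.

Variable Gam : forall T : member U, epi T G -> value X T -> V -> Prop.
Hypotheses (GamL : forall T f, linear_relation (@Gam T f))
  (Gam0 : forall T f v, @Gam T f 0 v -> v = 0)
  (Gam_pull : forall (S T : member U) (a : epi S T) f x v,
    @Gam T f x v -> @Gam S (epi_comp f a) (pull X a x) v).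

Let J : eqType := {i : model U & epi (model_group i) G}.
Let dom (j : J) : member U := model_group (tag j).
Let str (j : J) : epi (dom j) G := tagged j.
Let idx (i : model U) (f : epi (model_group i) G) : J :=
  Tagged (fun i => epi (model_group i) G) f.
Let D := iprod (fun j : J => value X (dom j)).
Let D_at (i : model U) (f : epi (model_group i) G) (x : value X (model_group i)) : D :=
  @single k J (fun j => value X (dom j)) (idx f) x.

(** The linear equations for a cocone extending [Gam], as values imposed on a
    linear map out of the space of all families over models [i] with a
    surjection to [G]. *)
Inductive imposed : D -> V -> Prop :=
  | imposed_value (i : model U) (f : epi (model_group i) G) x v :
      @Gam _ f x v -> imposed (D_at f x) v
  | imposed_pull (h i : model U) (a : epi (model_group h) (model_group i))
      (f : epi (model_group i) G) x :
      imposed (D_at (epi_comp f a) (pull X a x) - D_at f x) 0.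

Inductive imposed_span : D -> V -> Prop :=
  | imposed_span0 : imposed_span 0 0
  | imposed_spanS c d v e w : imposed d v -> imposed_span e w ->
      imposed_span (c *: d + e) (c *: v + w).

Lemma average_value (K T : member U) (g : epi K G) (f : epi T G) x v :
  (0 < #|[set d : epi K T | epi_comp f d == g]|)%N ->
  @Gam T f x v -> @Gam K g (average g f x) v.
Proof.
move=> pos xv; rewrite /average; set n := #|_|.
have -> : v = (n%:R : k)^-1 *: \sum_(d : epi K T | epi_comp f d == g) v.
  by rewrite sumr_const -cardsE -/n -scaler_nat scalerA mulVf ?scale1r ?natr_neq0.
apply: linear_relationZ => //; apply: linear_relation_sum => // d /eqP <-.
exact: Gam_pull.
Qed.

Let total (r : seq J) (K : member U) (g : epi K G) (d : D) : value X K :=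
  \sum_(j <- r) average g (str j) (d j).

Lemma total_linear (r : seq J) (K : member U) (g : epi K G) : linear (total r g).
Proof.
move=> c d e; rewrite /total scaler_sumr -big_split; apply: eq_bigr => j _.
exact: (average_linear g (str j)).
Qed.

Lemma total_at (r : seq J) (K : member U) (g : epi K G) (i : model U)
    (f : epi (model_group i) G) (x : value X (model_group i)) :
  uniq r -> idx f \in r -> total r g (D_at f x) = average g f x.
Proof.
move=> ur fr; rewrite /total (bigD1_seq _ fr ur) /= {1}/D_at singleE.
rewrite big1 ?addr0 // => j /eqP nj; rewrite /D_at single_neq.
  by rewrite -[LHS](linear_ofE (average_linear g (str j))) linear0.
by move=> e; apply: nj.
Qed.

(** A consequence of the imposed equations uses finitely many of them, hence
    finitely many groups over [G]. Averaging over a group [K] that is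
    homogeneous for these turns it into one of the prescribed values at [K]. *)
Lemma imposed_span_total d v : imposed_span d v ->
  exists s : seq J, forall (r : seq J) (K : member U) (g : epi K G),
    uniq r -> {subset s <= r} ->
    (forall j, j \in r ->
      (0 < #|[set d : epi K (dom j) | epi_comp (str j) d == g]|)%N) ->
    (forall (i j : J) (a : epi (dom i) (dom j)) x,
      i \in r -> j \in r -> epi_comp (str j) a = str i ->
      average g (str i) (pull X a x) = average g (str j) x) ->
    @Gam K g (total r g d) v.
Proof.
elim=> [|c e u e' u' eu _ [s sP]].
  exists [::] => r K g _ _ _ _.
  by rewrite -[total r g 0](linear_ofE (total_linear r g)) linear0; case: (GamL g).
case: eu => [i f x v0 xv|h i a f x].
  exists (idx f :: s) => r K g ur sr pos tr.
  have fr : idx f \in r by apply: sr; apply: mem_head.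
  rewrite total_linear total_at //.
  have ss : {subset s <= r} by move=> j js; apply: sr; rewrite in_cons js orbT.
  apply: (GamL g).2; last exact: sP r K g ur ss pos tr.
  by apply: average_value => //; apply: (pos (idx f)).
exists [:: idx (epi_comp f a), idx f & s] => r K g ur sr pos tr.
have fr : idx f \in r by apply: sr; rewrite !inE eqxx orbT.
have far : idx (epi_comp f a) \in r by apply: sr; rewrite !inE eqxx.
rewrite total_linear; apply: (GamL g).2; last first.
  have ss : {subset s <= r}.
    by move=> j js; apply: sr; rewrite 2!in_cons; apply/orP; right; apply/orP; right.
  exact: sP r K g ur ss pos tr.
rewrite -[total r g _](linear_ofE (total_linear r g)) linearB /= !total_at //.
rewrite (tr (idx (epi_comp f a)) (idx f) a x far fr) // subrr.
by case: (GamL g).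
Qed.

(** A linear map subject to the imposed equations exists because, by
    [imposed_span_total], they force no nonzero value at zero. It describes the
    cocone at the models, and isomorphisms carry it to all groups. *)
Lemma cocone_exists :
  exists psi, cocone psi /\ forall T f x v, @Gam T f x v -> psi T f x = v.
Proof.
have spanL : linear_relation imposed_span.
  split=> [|c d e v w dv ew]; first exact: imposed_span0.
  elim: dv => [|b d' v' d'' v'' dv' _ IH]; first by rewrite !scaler0 !add0r.
  rewrite !scalerDr !scalerA -!addrA; exact: imposed_spanS.
have gen d v : imposed d v -> imposed_span d v.
  move=> dv; rewrite -[d]addr0 -[v]addr0 -[d]scale1r -[v]scale1r.
  by apply: imposed_spanS dv imposed_span0.
have span0 v : imposed_span 0 v -> v = 0.
  move=> /imposed_span_total[s sP].
  have [K [g [pos tr]]] := average_pull str (undup s).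
  apply: (Gam0 (f := g)).
  have := sP (undup s) K g (undup_uniq s) _ pos tr.
  rewrite -[total _ g 0](linear_ofE (total_linear _ g)) linear0.
  by apply=> j; rewrite mem_undup.
(* The full relation serves as constraint: only the equations restrict [Psi]. *)
have [Psi [_ PsiP]] := linear_selection spanL
  (conj I (fun _ _ _ _ _ _ _ => I) : linear_relation (fun _ _ => True))
  (fun _ _ _ => I) (fun _ => ex_intro _ 0 I) span0.
pose sh T := cid (model_cover T U_replete).
pose to T := cid (svalP (sh T)); pose fro T := cid (svalP (to T)).
have toK T : epi_comp (sval (fro T)) (sval (to T)) = epi_id T.
  by have [] := svalP (fro T).
have froK T : epi_comp (sval (to T)) (sval (fro T)) = epi_id _.
  by have [] := svalP (fro T).
exists (fun T f x => Psi (D_at (epi_comp f (sval (fro T))) (pull X (sval (fro T)) x))).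
split; first split.
- move=> T f c x y; rewrite -linearP; apply: congr1.
  by rewrite linearP; apply: single_linear.
- move=> S T a f x; apply/eqP; rewrite -subr_eq0 -linearB; apply/eqP.
  pose b := epi_comp (sval (to T)) (epi_comp a (sval (fro S))).
  apply: PsiP; apply: gen.
  have bE : epi_comp (sval (fro T)) b = epi_comp a (sval (fro S)).
    by rewrite /b epi_compA toK epi_comp1.
  have -> : epi_comp (epi_comp f a) (sval (fro S)) =
            epi_comp (epi_comp f (sval (fro T))) b.
    by rewrite -!epi_compA bE.
  rewrite -pull_comp -bE pull_comp; exact: imposed_pull.
move=> T f x v xv; apply: PsiP; apply: gen; apply: imposed_value.
exact: Gam_pull.
Qed.

End Values.
End Cocones.

(** * Reduced cocones *)

Section Kernels.
Implicit Types (G Q : finGroupType).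

(** The quotient by the product of the two kernels. *)
Lemma join_epi G Q R (r : epi G Q) (s : epi G R) :
  exists (J : finGroupType) (v : epi G J), forall g h,
    v g = v h <-> exists g', r g = r g' /\ s g' = s h.
Proof.
have [N nN Nr] := kernel_epi r; have [M nM Ms] := kernel_epi s.
have nNM : M \subset 'N(N) by apply: subset_trans (subsetT _) (normal_norm nN).
have [v vNM] := quotient_epi (normalY nN nM).
exists (coset_of (N <*> M)), v => g h.
have eqE Q' (f : epi G Q') x y : (f x = f y) <-> (f (x * y^-1) == 1).
  by rewrite epiM epiV -eq_mulgV1; split=> [/eqP|/eqP].
rewrite eqE vNM /= norm_joinEr //; split=> [/mulsgP[n m nNn mMm gh]|[g' [rg sg]]].
  exists (n^-1 * g); split; apply/eqE; rewrite -?Nr -?Ms.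
    by rewrite invMg invgK mulgA mulgV mul1g.
  by rewrite -mulgA gh mulKg.
rewrite -[g](mulgKV g') -mulgA; apply: mem_mulg.
  by rewrite Nr; apply/eqE.
by rewrite Ms; apply/eqE.
Qed.

Lemma ltn_card_epi G Q (r : epi G Q) : ~ injective r -> (#|Q| < #|G|)%N.
Proof.
move=> ninj; rewrite ltn_neqAle leq_card_epi // andbT; apply/negP => /eqP QG.
apply: ninj => x y; apply: (@imset_injP _ _ r [set: G] _); rewrite ?inE //.
rewrite cardsT -QG -[#|Q|]cardsT (_ : r @: _ = [set: Q]) //.
by apply/setP => z; rewrite inE; have [u <-] := epi_surj r z; rewrite imset_f.
Qed.

End Kernels.

Section Reduction.
Variables (k : fieldType) (U : FinGrp -> Prop).
Hypotheses (U_multiplicative : multiplicative_family U)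
  (U_global : global_family U).
Local Open Scope ring_scope.

Variables (X : AU U k) (V : lmodType k).

Definition functionals (G : member U) := forall T : member U, epi T G -> value X T -> V.

Definition at_roof (G T : member U) (psi : functionals G) (s : roof T G) (x : value X T) : V :=
  psi (apex s) (right_leg s) (pull X (left_leg s) x).

(** Both sides are computed on the subgroup of pairs: each roof surjects onto
    it. *)
Lemma at_roof_eq (G T : member U) (psi : functionals G) (s s' : roof T G) x :
  cocone psi -> (forall t g, legs s t g <-> legs s' t g) ->
  at_roof psi s x = at_roof psi s' x.
Proof.
move=> [_ nat] ss'.
have [w [winj wP]] := roof_image U_multiplicative U_global (left_leg s) (right_leg s).
rewrite /at_roof; have [c [<- <-]] := roof_factor winj wP.
have [t g|c' [<- <-]] := @roof_factor _ _ _ _ (left_leg s') (right_leg s') w winj.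
  by rewrite wP; apply: ss'.
by rewrite !pull_comp !nat.
Qed.

Definition fiber (T G : member U) (Q : finGroupType) (f : epi T Q) (r : epi G Q) :
    roof T G :=
  sval (cid (fiber_product U_multiplicative U_global f r)).

Lemma legs_fiber (T G : member U) (Q : finGroupType) (f : epi T Q) (r : epi G Q) t g :
  legs (fiber f r) t g <-> f t = r g.
Proof. exact: (svalP (cid (fiber_product U_multiplicative U_global f r))). Qed.

(** A cocone over [G] induces one over a quotient [Q] of [G], by pulling back
    to the fibre product of [T] and [G] over [Q]. *)
Definition along (G : member U) (Q : finGroupType) (r : epi G Q) (psi : functionals G)
    (T : member U) (f : epi T Q) (x : value X T) : V :=
  at_roof psi (fiber f r) x.

Lemma along_pull (G : member U) (Q : finGroupType) (r : epi G Q) (psi : functionals G)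
    (S T : member U) (a : epi S T) (f : epi S Q) (x : value X T) (s : roof T G) :
  cocone psi ->
  (forall t g, legs s t g <-> exists y, a y = t /\ f y = r g) ->
  along r psi f (pull X a x) = at_roof psi s x.
Proof.
move=> psiC sP; rewrite /along /at_roof -pull_comp.
apply: (@at_roof_eq _ _ psi
  (Roof (epi_comp a (left_leg (fiber f r))) (right_leg (fiber f r)))) => // t g.
rewrite sP /legs /=; split=> [[w [<- <-]]|[y [<- /legs_fiber[w [wy <-]]]]].
  exists (left_leg (fiber f r) w); rewrite epi_compE; split=> //.
  by apply/legs_fiber; exists w.
by exists w; rewrite epi_compE wy.
Qed.

Lemma along_at (G : member U) (Q : finGroupType) (r : epi G Q) (psi : functionals G)
    (T : member U) (f : epi T Q) (x : value X T) (s : roof T G) :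
  cocone psi -> (forall t g, legs s t g <-> f t = r g) ->
  along r psi f x = at_roof psi s x.
Proof. by move=> psiC sP; apply: at_roof_eq => // t g; rewrite legs_fiber sP. Qed.

Lemma at_roof_linear (G T : member U) (psi : functionals G) (s : roof T G) :
  cocone psi -> linear (at_roof psi s).
Proof. by move=> [psiL _] c x y; rewrite /at_roof linearP psiL. Qed.

Lemma along_cocone (G Q : member U) (r : epi G Q) (psi : functionals G) :
  cocone psi -> cocone (along r psi).
Proof.
move=> psiC; split=> [T f|S T a f x]; first exact: at_roof_linear.
apply: along_pull => // t g; rewrite legs_fiber; split=> [ft|[y [<- <-]]].
  by have [y ay] := epi_surj a t; exists y; rewrite epi_compE ay.
by rewrite epi_compE.
Qed.

(** The operator E_N for N the kernel of [r]. *)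
Definition spread (G : member U) (Q : finGroupType) (r : epi G Q) (psi : functionals G) :
    functionals G :=
  fun T f x => along r psi (epi_comp r f) x.

Section OverOneGroup.
Variable G : member U.
Implicit Types psi chi : functionals G.

Lemma spread_cocone (Q : finGroupType) (r : epi G Q) psi :
  cocone psi -> cocone (spread r psi).
Proof.
move=> psiC; split=> [T f|S T a f x]; first exact: at_roof_linear.
rewrite /spread epi_compA; apply: along_pull => // t g.
rewrite legs_fiber; split=> [ft|[y [<- <-]]]; last by rewrite -epi_compE.
by have [y ay] := epi_surj a t; exists y; rewrite epi_compE ay.
Qed.

Lemma spread_eq (Q R : finGroupType) (r : epi G Q) (s : epi G R) psi
    (T : member U) (f : epi T G) x :
  cocone psi -> (forall g h, r g = r h <-> s g = s h) ->
  spread r psi f x = spread s psi f x.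
Proof.
move=> psiC rs; apply: along_at => // t g.
by rewrite legs_fiber !epi_compE rs.
Qed.

(** Both pullbacks together are evaluation at one roof: the composite of the
    two relations. *)
Lemma spread_spread (Q R : finGroupType) (r : epi G Q) (s : epi G R) psi
    (T : member U) (f : epi T G) x (w : roof T G) :
  cocone psi ->
  (forall t g, legs w t g <-> exists h, r (f t) = r h /\ s h = s g) ->
  spread r (spread s psi) f x = at_roof psi w x.
Proof.
move=> psiC wP; apply: along_pull => // t g; rewrite wP; split.
  move=> [h [rh sh]]; have [|u [ut uh]] := (legs_fiber (epi_comp r f) r t h).2.
    by rewrite epi_compE.
  by exists u; rewrite epi_compE uh.
move=> [u [ut sg]]; exists (right_leg (fiber (epi_comp r f) r) u).
rewrite -sg epi_compE; split=> //; rewrite -epi_compE.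
by apply/legs_fiber; exists u.
Qed.

Lemma spread_join (Q R J : finGroupType) (r : epi G Q) (s : epi G R) (v : epi G J) psi
    (T : member U) (f : epi T G) x :
  cocone psi -> (forall g h, v g = v h <-> exists g', r g = r g' /\ s g' = s h) ->
  spread r (spread s psi) f x = spread v psi f x.
Proof.
move=> psiC vP; apply: spread_spread => // t g.
by rewrite legs_fiber epi_compE vP.
Qed.

Lemma spreadK (Q : finGroupType) (r : epi G Q) psi (T : member U) (f : epi T G) x :
  cocone psi -> spread r (spread r psi) f x = spread r psi f x.
Proof.
move=> psiC; apply: spread_join => // g h; split=> [rgh|[g' [-> ->]] //].
by exists g.
Qed.

Lemma spreadC (Q R : finGroupType) (r : epi G Q) (s : epi G R) psi
    (T : member U) (f : epi T G) x :
  cocone psi -> spread r (spread s psi) f x = spread s (spread r psi) f x.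
Proof.
move=> psiC; have [J [v vP]] := join_epi r s.
rewrite (spread_join _ _ psiC vP); apply/esym/spread_join => // g h; rewrite vP.
by split=> -[g' [gg' g'h]]; exists (g * g'^-1 * h)%g;
  rewrite !epiM !epiV gg' g'h mulgKV mulgV mul1g.
Qed.

(** All operators E_N with N nontrivial vanish at [x]. *)
Definition reduced_at psi (T : member U) (f : epi T G) (x : value X T) : Prop :=
  forall (Q : finGroupType) (r : epi G Q), ~ injective r -> spread r psi f x = 0.

Definition reduced psi : Prop :=
  forall (T : member U) (f : epi T G) (x : value X T), reduced_at psi f x.

(** Applies 1 - E_N for all nontrivial N in turn. As the operators commute and
    are idempotent, each factor kills the image of its E_N and keeps what the
    previous ones have achieved. *)
Lemma reduction psi : cocone psi ->
  exists chi, [/\ cocone chi, reduced chi & forall (T : member U) (f : epi T G) x,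
    reduced_at psi f x -> chi T f x = psi T f x].
Proof.
move=> psiC.
suff [chi [chiC chiR chiE]] : exists chi, [/\ cocone chi,
    forall N, N \in enum {group G} -> forall (Q : finGroupType) (r : epi G Q),
      ~ injective r -> (forall g, (g \in N) = (r g == 1%g)) ->
      forall (T : member U) (f : epi T G) x, spread r chi f x = 0
    & forall (T : member U) (f : epi T G) x, reduced_at psi f x ->
      chi T f x = psi T f x /\ reduced_at chi f x].
  exists chi; split=> // [T f x Q r ninj|T f x /chiE[]//].
  have [N _ Nr] := kernel_epi r.
  by apply: (chiR N); rewrite ?mem_enum.
elim: (enum _) => [|N s [chi [chiC chiR chiE]]]; first by exists psi.
have [[Q [r [ninj Nr]]]|none] := pselect (exists (Q : finGroupType) (r : epi G Q),
    ~ injective r /\ forall g, (g \in N) = (r g == 1%g)); last first.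
  exists chi; split=> // M; rewrite inE => /predU1P[->|/chiR //] Q r ninj Nr.
  by case: none; exists Q, r.
pose chi' : functionals G := fun T f x => chi T f x - spread r chi f x.
have [rL rnat] := spread_cocone r chiC.
have spread' (R : finGroupType) (q : epi G R) (T : member U) (f : epi T G) x :
  spread q chi' f x = spread q chi f x - spread q (spread r chi) f x by [].
exists chi'; split.
- split=> [T f c x y|S T a f x]; last by rewrite /chi' rnat chiC.2.
  by rewrite /chi' rL chiC.1 opprD scalerBr addrACA.
- move=> M Ms R q qninj Mq T f x; rewrite spread'.
  move: Ms; rewrite inE => /predU1P[MN|Ms]; last first.
    by rewrite spreadC // (chiR M Ms R q qninj Mq) [X in _ - X](chiR M Ms R q qninj Mq) subrr.
  have qr g h : q g = q h <-> r g = r h.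
    have eqE Q' (e : epi G Q') y z : (e y = e z) <-> (e (y * z^-1)%g == 1%g).
      by rewrite epiM epiV -eq_mulgV1; split=> [/eqP|/eqP].
    by rewrite !eqE -Mq -Nr MN.
  by rewrite !(spread_eq _ _ _ qr) // ?spreadK ?subrr //; apply: spread_cocone.
move=> T f x /chiE[chiE0 chi_red]; split.
  by rewrite /chi' (chi_red _ _ ninj) subr0.
move=> R q qninj; rewrite spread' (chi_red _ _ qninj).
have [J [v vP]] := join_epi q r.
rewrite (spread_join _ _ chiC vP) chi_red ?subrr // => vinj; apply: qninj => g h qgh.
by apply: vinj; apply/vP; exists h.
Qed.

(** Let N be the image under [f] of the kernel of [a]; it is nontrivial, as [f]
    would factor otherwise. The pairs [(a s, g)] with [f s] and [g] congruent
    modulo N are just the pairs [(a s, f s)], so the value at hand equals its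
    image under E_N. *)
Lemma reduced_pull chi (S T : member U) (a : epi S T) (f : epi S G) x :
  cocone chi -> reduced chi -> (forall h : epi T G, epi_comp h a <> f) ->
  chi S f (pull X a x) = 0.
Proof.
move=> chiC chiR nf.
have [K nK Ka] := kernel_epi a.
have nN : (epi_morphism f @* K)%G <| [set: G].
  have /= := morphim_normal (epi_morphism f) nK.
  rewrite [X in _ <| X -> _](_ : _ = [set: G]) //; apply/setP => y; rewrite inE.
  by have [z <-] := epi_surj f y; apply: (mem_morphim (epi_morphism f)); rewrite inE.
have [q qN] := quotient_epi nN.
have qE y z : q y = q z <-> exists2 n, a n = 1%g & y = (z * f n)%g.
  split=> [/esym qyz|[n an ->]]; last first.
    have : f n \in (epi_morphism f @* K)%G.
      by apply: (mem_morphim (epi_morphism f)); rewrite ?inE ?Ka ?an.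
    by rewrite -qN epiM => /eqP ->; rewrite mulg1.
  have : (z^-1 * y)%g \in (epi_morphism f @* K)%G.
    by rewrite -qN epiM epiV qyz mulVg.
  case/morphimP => n _; rewrite Ka => /eqP an fn; exists n => //.
  by rewrite /= in fn; rewrite -fn mulKVg.
have ninj : ~ injective q.
  move=> qinj; have [|h] := @epi_factor _ _ _ a f; last exact: nf.
  move=> y ay; apply: qinj; apply/qE; exists y => //.
  by rewrite mul1g.
rewrite -(chiR S f (pull X a x) _ _ ninj).
apply/esym; apply: (@along_pull _ _ _ _ _ _ _ _ _ (Roof a f)) => // t g.
split=> [[y [<- <-]]|[y [<- ]]]; first by exists y; rewrite epi_compE.
rewrite epi_compE => /qE[n an fy]; exists (y * n^-1)%g.
by rewrite /= !epiM !epiV an invg1 mulg1 fy mulgK.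
Qed.

End OverOneGroup.
End Reduction.

Section Separation.
Variables (k : fieldType) (U : FinGrp -> Prop).
Hypotheses (U_replete : replete U) (U_multiplicative : multiplicative_family U)
  (U_global : global_family U).
Local Open Scope ring_scope.
Variables (X : AU U k).

(** Passing from [G] to a quotient at which some E_N does not kill [x] makes
    [G] smaller; where no such quotient is left, the reduction does not
    change the value at [x]. *)
Lemma reduced_separation (V : lmodType k) (T : member U) (x : value X T)
    (psi : functionals X V T) :
  cocone psi -> psi T (epi_id T) x <> 0 ->
  exists (i : model U) (p : epi T (model_group i))
      (chi : functionals X V (model_group i)),
    [/\ cocone chi, reduced U_multiplicative U_global chi & chi T p x <> 0].
Proof.
move=> psiC psi0.
(* Replacing a quotient of [G] by an isomorphic model keeps the value at [x]. *)
have step (G : member U) (q : epi T G) (Q : finGroupType) (r : epi G Q)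
    (ps : functionals X V G) : cocone ps ->
    along U_multiplicative U_global r ps (epi_comp r q) x <> 0 ->
    exists (i : model U) (r' : epi G (model_group i)) (p : epi T (model_group i))
      (chi : functionals X V (model_group i)),
      [/\ cocone chi, (forall g h, r g = r h <-> r' g = r' h) & chi T p x <> 0].
  move=> psC ps0; pose Q' : member U := exist U Q (U_epi U_replete U_global r).
  have [i [f [g [fg gf]]]] := model_cover Q' U_replete.
  pose r' : epi G (model_group i) := epi_comp f (r : epi G Q').
  have rr' g1 h : r g1 = r h <-> r' g1 = r' h.
    rewrite !epi_compE; split=> [->//|/(congr1 g)].
    by rewrite -!(epi_compE g f) gf !epi_idE.
  exists i, r', (epi_comp r' q), (along U_multiplicative U_global r' ps).
  split=> //; first exact: along_cocone.
  by move: ps0; rewrite [along _ _ r ps _ _](spread_eq _ _ q x psC rr').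
have [i [_ [p [chi [chiC _ chi0]]]]] : exists (i : model U)
    (r' : epi T (model_group i)) (p : epi T (model_group i))
      (chi : functionals X V (model_group i)),
      [/\ cocone chi, (forall g h, epi_id T g = epi_id T h <-> r' g = r' h) &
          chi T p x <> 0].
  apply: (step T (epi_id T) T (epi_id T) psi psiC).
  rewrite (along_at _ _ _ (s := Roof (epi_id T) (epi_id T)) psiC).
    by rewrite /at_roof /= pull_id.
  by move=> t g; split=> [[w [<- <-]]|];
    rewrite !epi_compE ?epi_idE // => ->; exists g; rewrite epi_idE.
have [m] := ubnP #|model_group i|; elim: m i p chi chiC chi0 => // m IHm i p chi chiC chi0 im.
have [redp|] := pselect (reduced_at U_multiplicative U_global chi p x).
  have [chi' [chiC' chiR' chiE]] := reduction U_multiplicative U_global chiC.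
  by exists i, p, chi'; split=> //; rewrite chiE.
move=> /existsNP[Q /existsNP[r /not_implyP[ninj rchi]]].
have [j [r' [p' [chi' [chiC' rr' chi0']]]]] := step _ p Q r chi chiC rchi.
apply: (IHm j p' chi' chiC' chi0').
apply: leq_trans (_ : #|model_group i| <= m)%N => //.
by apply: (ltn_card_epi (r := r')) => r'inj; apply: ninj => g h /rr'/r'inj.
Qed.

End Separation.

(** * Free objects, epimorphisms and monomorphisms *)

Section Classes.
Local Open Scope ring_scope.
Implicit Types Q R S T : finGroupType.

Definition cls S T (f : epi S T) : group_hom S T := class_of (valP f).

Lemma cls_surj S T (a : group_hom S T) : exists f, a = cls f.
Proof.
have [f [fP ->]] := group_homP a.
by exists (exist (fun f => is_surjhom f) f fP); apply: class_of_eq.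
Qed.

Lemma cls_comp R S T (f : epi S T) (e : epi R S) :
  group_comp (cls f) (cls e) = cls (epi_comp f e).
Proof. by rewrite group_comp_class; apply: class_of_eq. Qed.

Lemma cls_eq S T (f g : epi S T) : cls f = cls g <-> exists h, g = epi_conj f h.
Proof.
split=> [/(congr1 val) /= fg|[h ->]].
  have : val g \in conjugacy_class (val f).
    rewrite fg; apply/imsetP; exists 1%g; rewrite ?inE //.
    by apply/ffunP => x; rewrite ffunE conjg1.
  case/imsetP => h _ gE; exists h; apply: epi_eqP => x.
  by rewrite epi_conjE /epi_fun gE ffunE.
have vE x : val (epi_conj f h) x = (val f x ^ h)%g by apply: epi_conjE.
apply: val_inj; apply/setP => u; apply/imsetP/imsetP => -[y _ ->].
  exists (h^-1 * y)%g; rewrite ?inE //; apply/ffunP => x.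
  by rewrite [LHS]ffunE [RHS]ffunE vE -conjgM mulKVg.
exists (h * y)%g; rewrite ?inE //; apply/ffunP => x.
by rewrite [LHS]ffunE [RHS]ffunE vE conjgM.
Qed.

Lemma cls_conj S T (f : epi S T) h : cls (epi_conj f h) = cls f.
Proof. by apply/esym/cls_eq; exists h. Qed.

Lemma epi_conj_comp R S T (f : epi S T) (e : epi R S) h :
  epi_conj (epi_comp f e) h = epi_comp (epi_conj f h) e.
Proof. by apply: epi_eqP => x; rewrite !(epi_conjE, epi_compE). Qed.

Lemma group_comp_cancel R S T (b c : group_hom S T) (a : group_hom R S) :
  group_comp b a = group_comp c a -> b = c.
Proof.
have [f ->] := cls_surj b; have [g ->] := cls_surj c; have [e ->] := cls_surj a.
rewrite !cls_comp => /cls_eq[h]; rewrite epi_conj_comp => /epi_cancel ->.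
by rewrite cls_conj.
Qed.

Lemma group_compA Q R S T (c : group_hom S T) (b : group_hom R S) (a : group_hom Q R) :
  group_comp c (group_comp b a) = group_comp (group_comp c b) a.
Proof. exact: (@Defs.compA FinGrp Q R S T c b a). Qed.

Lemma group_comp1 S T (a : group_hom S T) : group_comp a (group_id S) = a.
Proof. exact: (@comp_idr FinGrp S T a). Qed.

Lemma group_1comp S T (a : group_hom S T) : group_comp (group_id T) a = a.
Proof. exact: (@comp_idl FinGrp S T a). Qed.

End Classes.

Section Action.
Local Open Scope ring_scope.
Variables (k : fieldType) (U : FinGrp -> Prop).
Implicit Types (X Y : AU U k) (R S T : member U).

Definition act_on X S T (a : group_hom S T) : {linear value X T -> value X S} :=
  @fmap _ _ X T S a.

Lemma act_cls X S T (f : epi S T) : act_on X (cls f) = pull X f. Proof. by []. Qed.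

Lemma act_id X T (x : value X T) : act_on X (group_id T) x = x.
Proof. by rewrite /act_on [@fmap _ _ X T T _](fmap_id X T). Qed.

Lemma act_comp X R S T (b : group_hom S T) (a : group_hom R S) (x : value X T) :
  act_on X (group_comp b a) x = act_on X a (act_on X b x).
Proof. by rewrite /act_on [@fmap _ _ X T R _](@fmap_comp _ _ X T S R a b). Qed.

Definition nat_at X Y (h : nat_trans X Y) (T : member U) : {linear value X T -> value Y T} :=
  component h T.

Lemma at_act X Y (h : nat_trans X Y) S T (a : group_hom S T) (x : value X T) :
  nat_at h S (act_on X a x) = act_on Y a (nat_at h T x).
Proof.
by have := naturality h (x := T) (y := S) a => /(congr1 (fun f : {linear _ -> _} => f x)).
Qed.

Lemma make_nat_trans X Y (h : forall T : member U, {linear value X T -> value Y T}) :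
  (forall S T (a : group_hom S T) x, h S (act_on X a x) = act_on Y a (h T x)) ->
  exists n : nat_trans X Y, forall T x, nat_at n T x = h T x.
Proof.
move=> hact.
have nat (x y : opposite (full_subcategory U)) (f : Defs.hom x y) :
    Defs.comp (h y : Defs.hom (fobj X y) (fobj Y y)) (fmap X f) =
    Defs.comp (fmap Y f) (h x : Defs.hom (fobj X x) (fobj Y x)).
  by apply: linearP_eq => v; apply: hact.
by exists (@NatTrans _ _ X Y h nat).
Qed.

Lemma nat_trans_eq X Y (h h' : nat_trans X Y) :
  (forall T x, nat_at h T x = nat_at h' T x) -> h = h'.
Proof. by move=> hh'; apply: nat_transP => T; apply: linearP_eq => x; apply: hh'. Qed.

End Action.

Section Free.
Local Open Scope ring_scope.
Variables (k : fieldType) (U : FinGrp -> Prop).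
Variable V : model U -> lmodType k.

Definition free_value (T : member U) : lmodType k :=
  iprod (fun i : model U => {ffun group_hom T (model_group i) -> V i} : lmodType k).

(** The morphism [c] with coefficient [p i c] is sent to its composite with
    [a]. *)
Definition free_act_fun (S T : member U) (a : group_hom S T) (p : free_value T) :
    free_value S :=
  fun i => [ffun b => \sum_(c | group_comp c a == b) p i c].

Lemma free_act_linear (S T : member U) (a : group_hom S T) : linear (free_act_fun a).
Proof.
move=> c p q; apply: iprodP => i; apply/ffunP => b.
rewrite iprodDE iprodZE !ffunE /= scaler_sumr -big_split; apply: eq_bigr => d _.
by rewrite iprodDE iprodZE !ffunE.
Qed.

Definition free_act (S T : member U) (a : group_hom S T) :
  {linear free_value T -> free_value S} := linear_of (free_act_linear a).

Lemma free_actE (S T : member U) (a : group_hom S T) p i b :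
  free_act a p i b = \sum_(c | group_comp c a == b) p i c.
Proof. by rewrite [free_act a p]linear_ofE ffunE. Qed.

Lemma free_act_id (T : member U) p : free_act (group_id T) p = p.
Proof.
apply: iprodP => i; apply/ffunP => b; rewrite free_actE.
by rewrite (big_pred1 b) // => c /=; rewrite group_comp1.
Qed.

Lemma free_act_comp (R S T : member U) (b : group_hom S T) (a : group_hom R S) p :
  free_act (group_comp b a) p = free_act a (free_act b p).
Proof.
apply: iprodP => i; apply/ffunP => d; rewrite !free_actE.
rewrite (partition_big (fun c => group_comp c b) (fun c => group_comp c a == d)) /=.
  apply: eq_bigr => c /eqP ca; rewrite free_actE; apply: eq_bigl => e.
  by apply/andP/idP => [[]//|/eqP eb]; rewrite group_compA eb ca !eqxx.
by move=> c; rewrite group_compA.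
Qed.

Definition free_functor : AU U k.
Proof.
refine (@Functor (opposite (full_subcategory U)) (Vect k) free_value
  (fun T S a => @free_act S T a) _ _).
- by move=> T; apply: linearP_eq => p; apply: free_act_id.
- by move=> T S R b a; apply: linearP_eq => p; apply: free_act_comp.
Defined.

Lemma act_freeE (S T : member U) (a : group_hom S T) p i b :
  (act_on free_functor a p : free_value S) i b =
  \sum_(c | group_comp c a == b) (p : free_value T) i c.
Proof. exact: free_actE. Qed.

(** Morphisms are epimorphisms, so [c] is the only one with composite
    [group_comp c a]. *)
Lemma act_free_comp (S T : member U) (a : group_hom S T) p i c :
  (act_on free_functor a p : free_value S) i (group_comp c a) = (p : free_value T) i c.
Proof.
rewrite act_freeE (big_pred1 c) // => d; apply/eqP/eqP => [|->] //.
exact: group_comp_cancel.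
Qed.

Lemma free_torsion_free : torsion_free free_functor.
Proof.
move=> S T a p q pq; apply: iprodP => i; apply/ffunP => c.
rewrite -(act_free_comp (T := T) (S := S) a).
by rewrite -[RHS](act_free_comp (T := T) (S := S) a) /act_on pq.
Qed.

Definition generator (i : model U) (v : V i) : free_value (model_group i) :=
  single (V := fun j => {ffun group_hom (model_group i) (model_group j) -> V j})
    [ffun c => if c == group_id _ then v else 0].

Lemma act_generator (T : member U) (i : model U) (c : group_hom T (model_group i))
    (v : V i) (j : model U) (d : group_hom T (model_group j)) :
  (act_on free_functor c (generator v) : free_value T) j d =
  single (V := fun j => {ffun group_hom T (model_group j) -> V j})
    [ffun d => if d == c then v else 0] j d.
Proof.
have [ij|nij] := pselect (i = j); last first.
  rewrite act_freeE single_neq // ffunE big1 // => e _.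
  by rewrite /generator single_neq // ffunE.
case: _ / ij in d *; rewrite act_freeE singleE ffunE /generator singleE.
have [->|ndc] := eqVneq d c.
  rewrite (bigD1 (group_id _)) /= ?group_1comp // ffunE eqxx big1 ?addr0 //.
  by move=> e /andP[_ /negPf ne]; rewrite ffunE ne.
rewrite big1 // => e /eqP ed; rewrite ffunE; case: eqP => // e1.
by rewrite -ed e1 group_1comp eqxx in ndc.
Qed.

Definition models_below (T : member U) : seq (model U) :=
  sval (cid (finitely_many_models T)).

Lemma models_below_uniq (T : member U) : uniq (models_below T).
Proof. by have [] := svalP (cid (finitely_many_models T)). Qed.

Lemma mem_models_below (T : member U) i (c : group_hom T (model_group i)) :
  i \in models_below T.
Proof.
have [f _] := cls_surj c.
by have [_] := svalP (cid (finitely_many_models T)); apply.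
Qed.

(** The list [models_below] depends on choices, but sums over it do not as long
    as the summands vanish at models that are not quotients. *)
Lemma sum_models_eq (M : nmodType) (F : model U -> M) (S T : member U) :
  (forall i, F i != 0 -> i \in models_below S /\ i \in models_below T) ->
  \sum_(i <- models_below S) F i = \sum_(i <- models_below T) F i.
Proof.
move=> FST.
have drop0 (s : seq (model U)) : \sum_(i <- s) F i = \sum_(i <- [seq i <- s | F i != 0]) F i.
  by rewrite big_filter [RHS]big_mkcond; apply: eq_bigr => i _; case: eqP.
rewrite drop0 [RHS]drop0; apply: perm_big; apply: uniq_perm;
  rewrite ?filter_uniq ?models_below_uniq // => i.
by rewrite !mem_filter; have [//|/FST[-> ->]] := eqVneq (F i) 0.
Qed.

Lemma free_sumE (T : member U) (J : Type) (s : seq J) (F : J -> free_value T) i c :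
  (\sum_(j <- s) F j : free_value T) i c = \sum_(j <- s) (F j) i c.
Proof.
elim: s => [|j s IH]; first by rewrite !big_nil iprod0E ffunE.
by rewrite !big_cons iprodDE ffunE IH.
Qed.

(** The sum is finite although the product need not be: this is where the
    product over all models turns into a direct sum. *)
Lemma free_decomposition (T : member U) (p : free_value T) :
  p = \sum_(i <- models_below T) \sum_(c : group_hom T (model_group i))
        (act_on free_functor c (generator (p i c)) : free_value T).
Proof.
apply: iprodP => j; apply/ffunP => d; rewrite free_sumE.
have termE i : (\sum_(c : group_hom T (model_group i))
    (act_on free_functor c (generator (p i c)) : free_value T)) j d =
    single (V := fun j => {ffun group_hom T (model_group j) -> V j}) (p i) j d.
  rewrite free_sumE; under eq_bigr => c _ do rewrite act_generator.
  have [ij|nij] := pselect (i = j); last first.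
    by rewrite single_neq // ffunE big1 // => c _; rewrite single_neq // ffunE.
  case: _ / ij d => d; rewrite singleE.
  under eq_bigr => c _ do rewrite singleE ffunE.
  by rewrite -big_mkcond (big_pred1 d) // => c; rewrite eq_sym.
under eq_bigr => i _ do rewrite termE.
rewrite (bigD1_seq j) ?models_below_uniq ?(mem_models_below d) //= singleE.
rewrite big1 ?addr0 // => i nij; rewrite single_neq ?ffunE //.
exact/eqP.
Qed.

Section Maps.
Variables (X : AU U k) (u : forall i, {linear V i -> value X (model_group i)}).

Definition free_map_fun (T : member U) (p : free_value T) : value X T :=
  \sum_(i <- models_below T) \sum_(c : group_hom T (model_group i)) act_on X c (u i (p i c)).

Lemma free_map_linear (T : member U) : linear (@free_map_fun T).
Proof.
move=> c p q; rewrite /free_map_fun scaler_sumr -big_split; apply: eq_bigr => i _.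
rewrite scaler_sumr -big_split; apply: eq_bigr => d _.
by rewrite iprodDE iprodZE !ffunE !linearP.
Qed.

Lemma free_map_act (S T : member U) (a : group_hom S T) (p : free_value T) :
  free_map_fun (act_on free_functor a p) = act_on X a (free_map_fun p).
Proof.
rewrite /free_map_fun linear_sum /=.
pose F i := \sum_(c : group_hom T (model_group i)) act_on X a (act_on X c (u i (p i c))).
transitivity (\sum_(i <- models_below S) F i).
  apply: eq_bigr => i _; rewrite /F.
  rewrite [RHS](partition_big (fun c => group_comp c a) xpredT) //=.
  apply: eq_bigr => b _; rewrite act_freeE !linear_sum; apply: eq_bigr => c /eqP <-.
  by rewrite act_comp.
rewrite (@sum_models_eq _ F S T) => [|i].
  by apply: eq_bigr => i _; rewrite linear_sum.
have [c _|none] := pickP (fun c : group_hom T (model_group i) => true).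
  by split; [exact: mem_models_below (group_comp c a) | exact: mem_models_below c].
by rewrite /F big1 ?eqxx // => c; have := none c.
Qed.

Lemma free_map_exists : exists h : nat_trans free_functor X,
  forall i (v : V i), nat_at h (model_group i) (generator v) = u i v.
Proof.
have [S T a p|h hE] := @make_nat_trans _ _ free_functor X
  (fun T => linear_of (@free_map_linear T)).
  by rewrite !linear_ofE free_map_act.
exists h => i v; rewrite hE [LHS]linear_ofE /free_map_fun.
have off j : i <> j -> \sum_(c : group_hom (model_group i) (model_group j))
    act_on X c (u j (generator v j c)) = 0.
  move=> nij; apply: big1 => c _; rewrite /generator single_neq //.
  by rewrite ffunE !linear0.
have on : \sum_(c : group_hom (model_group i) (model_group i))
    act_on X c (u i (generator v i c)) = u i v.
  have genE c : generator v i c = if c == group_id _ then v else 0.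
    by rewrite /generator singleE ffunE.
  rewrite (bigD1 (group_id (model_group i))) //= genE eqxx act_id.
  rewrite big1; first exact: addr0.
  by move=> c /negPf c1; rewrite genE c1 !linear0.
rewrite (bigD1_seq i (mem_models_below (group_id (model_group i)))
  (models_below_uniq (model_group i))) on.
rewrite big1; first exact: addr0.
by move=> j /eqP nji; apply: off => ij; exact: nji (esym ij).
Qed.

End Maps.

Lemma free_map_eq (X : AU U k) (h h' : nat_trans free_functor X) :
  (forall i (v : V i), nat_at h (model_group i) (generator v) =
                       nat_at h' (model_group i) (generator v)) -> h = h'.
Proof.
move=> hh'; apply: nat_trans_eq => T p; rewrite [p]free_decomposition !linear_sum.
apply: eq_bigr => i _; rewrite !linear_sum; apply: eq_bigr => c _.
by rewrite [LHS]at_act [RHS]at_act hh'.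
Qed.

End Free.

Section EpicMonic.
Local Open Scope ring_scope.
Variables (k : fieldType) (U : FinGrp -> Prop).
Hypothesis (U_replete : replete U).
Implicit Types X Y Z : AU U k.

(** Maps from an object [Y] to this functor correspond to linear forms on
    [Y T]; it is the dual of the functor represented by [T] in the other
    variable. *)
Definition cofree_value (T S : member U) : lmodType k :=
  iprod (fun _ : group_hom T S => (k^o : lmodType k)).

Definition cofree_act_fun (T S R : member U) (b : group_hom S R)
    (p : cofree_value T R) : cofree_value T S := fun c => p (group_comp b c).

Lemma cofree_act_linear (T S R : member U) (b : group_hom S R) :
  linear (@cofree_act_fun T S R b).
Proof. by []. Qed.

Definition cofree (T : member U) : AU U k.
Proof.
refine (@Functor (opposite (full_subcategory U)) (Vect k) (cofree_value T)
  (fun S R b => linear_of (@cofree_act_linear T R S b)) _ _).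
- move=> S; apply: linearP_eq => p; apply: iprodP => c.
  by congr (p _); apply: group_1comp.
- move=> S R Q b a; apply: linearP_eq => p; apply: iprodP => c.
  by congr (p _); rewrite -group_compA.
Defined.

(** A linear form that vanishes on the image at [T] but not at [y] would give a
    nonzero map to [cofree T] that vanishes on the image of [e]. *)
Lemma epic_surjective X Y (e : nat_trans X Y) : @epic (AU U k) X Y e ->
  forall (T : member U) y, exists x, nat_at e T x = y.
Proof.
move=> eE T y; apply: contrapT => ny.
pose R (w : value Y T) (c : k^o) := exists x, w = nat_at e T x + c *: y.
have RL : linear_relation R.
  split=> [|c v w a b [x ->] [x' ->]]; first by exists 0; rewrite linear0 scale0r addr0.
  by exists (c *: x + x'); rewrite linearP scalerDr scalerDl scalerA addrACA.
have R0 c : R 0 c -> c = 0.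
  move=> [x /esym/eqP]; rewrite addr_eq0 => /eqP ex; apply/eqP/negPn/negP => c0.
  by apply: ny; exists (- c^-1 *: x); rewrite linearZ /= ex scalerN scaleNr opprK scalerK.
have [lam [_ lamP]] := linear_selection RL
  (conj I (fun _ _ _ _ _ _ _ => I) : linear_relation (fun _ _ => True))
  (fun _ _ _ => I) (fun _ => ex_intro _ 0 I) R0.
have lamL S : linear (fun z : value Y S => (fun c => lam (act_on Y c z)) : cofree_value T S).
  by move=> c z w; apply: iprodP => d; rewrite iprodDE iprodZE !linearP.
have [S S' a z|h hE] := @make_nat_trans _ _ Y (cofree T) (fun S => linear_of (lamL S)).
  apply: iprodP => c; rewrite !linear_ofE; congr (lam _).
  by rewrite -act_comp.
have [S S' a z|h0 h0E] := @make_nat_trans _ _ Y (cofree T)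
    (fun S => (\0 : {linear value Y S -> cofree_value T S})%R).
  by rewrite [RHS]linear0.
have hh0 : h = h0.
  apply: eE; apply: nat_trans_eq => S x.
  rewrite -[LHS]/(nat_at h S (nat_at e S x)) -[RHS]/(nat_at h0 S (nat_at e S x)) hE h0E.
  apply: iprodP => c; rewrite linear_ofE -at_act -[RHS]/(0 : k^o); apply: lamP.
  by exists (act_on X c x); rewrite scale0r addr0.
have : lam y = 1 by apply: lamP; exists 0; rewrite linear0 add0r scale1r.
have lam0 : lam (act_on Y (group_id T) y) = 0.
  have := congr1 (fun q : cofree_value T T => q (group_id T)) (hE T y).
  by rewrite hh0 h0E => /esym.
rewrite act_id in lam0; rewrite lam0 => /esym/eqP.
by rewrite oner_eq0.
Qed.

(** An element [x] of the kernel at a model gives a map from a free object that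
    becomes zero after composition with [m]. *)
Lemma monic_injective X Y (m : nat_trans X Y) : @Defs.monic (AU U k) X Y m ->
  forall (T : member U) x, nat_at m T x = 0 -> x = 0.
Proof.
move=> mM.
suff inj_model (i : model U) (x : value X (model_group i)) : nat_at m _ x = 0 -> x = 0.
  move=> T x mx; have [i [f [g [fg gf]]]] := model_cover T U_replete.
  rewrite -[x]pull_id -gf pull_comp; rewrite (inj_model i (pull X g x)) ?linear0 //.
  by rewrite -act_cls at_act mx linear0.
move=> mx; pose y := single (V := fun j => value X (model_group j)) x.
have uL j : linear (fun c : k^o => c *: (y j : value X (model_group j))).
  by move=> c a b; rewrite scalerDl scalerA.
have [h hE] := free_map_exists (V := fun _ => (k^o : lmodType k)) (fun j => linear_of (uL j)).
have [h0 h0E] := free_map_exists (V := fun _ => (k^o : lmodType k))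
  (fun j => (\0 : {linear k^o -> value X (model_group j)})%R).
have hh0 : h = h0.
  apply: mM; apply: free_map_eq => j c.
  rewrite -[LHS]/(nat_at m _ (nat_at h _ (generator c))).
  rewrite -[RHS]/(nat_at m _ (nat_at h0 _ (generator c))).
  rewrite hE h0E linear_ofE linearZ linear0 /=.
  have [ij|nij] := pselect (i = j); last by rewrite /y single_neq // linear0 scaler0.
  by case: _ / ij; rewrite /y singleE mx scaler0.
have yi : y i = x by rewrite /y singleE.
have e : (1 : k) *: (y i : value X (model_group i)) = 0.
  by have := hE i 1; rewrite hh0 h0E => /esym.
by rewrite scale1r yi in e.
Qed.

Lemma surjective_epic X Y (e : nat_trans X Y) :
  (forall (T : member U) y, exists x, nat_at e T x = y) -> @epic (AU U k) X Y e.
Proof.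
move=> eS Z g h gh; apply: nat_trans_eq => T y; have [x <-] := eS T y.
by have := congr1 (fun n : nat_trans X Z => nat_at n T x) gh.
Qed.

Lemma injective_monic X Y (m : nat_trans X Y) :
  (forall (T : member U) x, nat_at m T x = 0 -> x = 0) -> @Defs.monic (AU U k) X Y m.
Proof.
move=> mI Z g h gh; apply: nat_trans_eq => T z; apply/eqP; rewrite -subr_eq0.
apply/eqP/mI; rewrite linearB; apply/eqP; rewrite subr_eq0; apply/eqP.
by have := congr1 (fun n : nat_trans Z Y => nat_at n T z) gh.
Qed.

End EpicMonic.

(** * Projectivity, injectivity and embeddings of free objects *)

Section FreeObjects.
Local Open Scope ring_scope.
Variables (k : fieldType) (U : FinGrp -> Prop).
Hypothesis k_char0 : [pchar k]%R =i pred0.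
Hypotheses (U_replete : replete U) (U_multiplicative : multiplicative_family U)
  (U_global : global_family U).
Implicit Types (X Y : AU U k).

Lemma linear_relation_eq0 (V W : lmodType k) :
  linear_relation (fun (x : V) (w : W) => x = 0 /\ w = 0).
Proof.
by split=> // c x y a b [-> ->] [-> ->]; rewrite !scaler0 !addr0.
Qed.

Lemma free_functor_projective (V : model U -> lmodType k) :
  @Defs.projective (AU U k) (free_functor V).
Proof.
move=> X Y e h epi_e.
have lift i : exists u : {linear V i -> value X (model_group i)},
    forall v, nat_at e _ (u v) = nat_at h _ (generator v).
  pose M (v : V i) x := nat_at e (model_group i) x = nat_at h _ (generator v).
  have gL : linear (@generator k U V i).
    move=> c v w; rewrite -single_linear; congr single; apply/ffunP => b.
    by rewrite !ffunE; case: eqP => // _; rewrite scaler0 addr0.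
  have ML : linear_relation M.
    split=> [|c v w x y]; rewrite /M; last by rewrite gL !linearP => -> ->.
    by rewrite -[generator 0](linear_ofE gL) !linear0.
  have [v x [-> ->]|v|x []|u [uM _]] :=
      @linear_selection k _ _ _ M (linear_relation_eq0 _ _) ML.
  - by case: ML.
  - exact: epic_surjective epi_e _ _.
  - by [].
  - by exists u.
pose u i := sval (cid (lift i)).
have [g gE] := free_map_exists u.
exists g; apply: free_map_eq => i v.
rewrite -[LHS]/(nat_at e _ (nat_at g _ (generator v))) gE.
exact: (svalP (cid (lift i))).
Qed.

(** Conjugation by [f s] after [f] is conjugation by [s] before [f], and the
    latter acts trivially on [X]. *)
Lemma cocone_conj X (V : lmodType k) (G T : member U) (psi : functionals X V G)
    (f : epi T G) h x : cocone psi -> psi T (epi_conj f h) x = psi T f x.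
Proof.
move=> [_ nat]; have [s <-] := epi_surj f h.
rewrite -(nat T T (epi_conj (epi_id T) s) f x) -act_cls cls_conj act_cls pull_id.
congr (psi T _ x); apply: epi_eqP => y.
by rewrite epi_compE !epi_conjE epi_idE !conjgE !(epiM, epiV).
Qed.

Lemma cocone_cls X (V : lmodType k) (G T : member U) (psi : functionals X V G)
    (f g : epi T G) x : cocone psi -> cls f = cls g -> psi T f x = psi T g x.
Proof. by move=> psiC /cls_eq[h ->]; rewrite cocone_conj. Qed.

(** Coefficient families of maps to a free object: by reducedness the
    coefficient of a pulled back element at [f] vanishes unless [f] factors,
    as it does for a free object. *)
Lemma map_to_free X (V : model U -> lmodType k)
    (chi : forall i, functionals X (V i) (model_group i)) :
  (forall i, cocone (chi i)) ->
  (forall i, reduced U_multiplicative U_global (chi i)) ->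
  exists h : nat_trans X (free_functor V),
    forall (T : member U) x i (f : epi T (model_group i)),
    (nat_at h T x : free_value V T) i (cls f) = chi i T f x.
Proof.
move=> chiC chiR.
pose rep (S T : member U) (c : group_hom S T) := sval (cid (cls_surj c)).
have repK (S T : member U) (c : group_hom S T) : cls (rep S T c) = c.
  exact: esym (svalP (cid (cls_surj c))).
pose F (T : member U) (x : value X T) : free_value V T :=
  fun i => [ffun c => chi i T (rep _ _ c) x].
have FE (T : member U) x i (f : epi T (model_group i)) : F T x i (cls f) = chi i T f x.
  by rewrite ffunE; apply: cocone_cls.
have FL T : linear (F T).
  move=> c x y; apply: iprodP => i; apply/ffunP => d.
  by rewrite iprodDE iprodZE !ffunE (chiC i).1.
have [S T a x|h hE] := @make_nat_trans _ _ X (free_functor V) (fun T => linear_of (FL T)).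
  apply: iprodP => i; apply/ffunP => b; rewrite !linear_ofE act_freeE.
  have [al ->] := cls_surj a; have [f ->] := cls_surj b; rewrite FE act_cls.
  have [[c /eqP cf]|none] := pselect (exists c : group_hom T (model_group i),
      group_comp c (cls al) == cls f).
    rewrite (big_pred1 c) => [|d]; last first.
      by rewrite -cf; apply/eqP/eqP => [/group_comp_cancel|->].
    have [g cE] := cls_surj c; rewrite cE FE -((chiC i).2 _ _ al).
    by apply: (cocone_cls _ (chiC i)); rewrite -cls_comp -cE.
  rewrite big1 => [|c cf]; last by case: none; exists c.
  apply: (reduced_pull _ (chiC i) (chiR i)) => g gf; apply: none.
  by exists (cls g); rewrite cls_comp gf.
by exists h => T x i f; rewrite hE; apply: FE.
Qed.

(** A map from [X] prescribes a cocone on the image of [m] in [Y]. The values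
    prescribed are reduced already, so that reduction keeps them. *)
Lemma free_functor_injective (V : model U -> lmodType k) :
  @injective_object (AU U k) (free_functor V).
Proof.
move=> X Y m h monic_m.
have mI := monic_injective U_replete monic_m.
have ext i : exists chi : functionals Y (V i) (model_group i),
    [/\ cocone chi, reduced U_multiplicative U_global chi &
     forall (T : member U) f x,
        chi T f (nat_at m T x) = (nat_at h T x : free_value V T) i (cls f)].
  pose Gam (T : member U) (f : epi T (model_group i)) y (v : V i) :=
    exists x, y = nat_at m T x /\ v = (nat_at h T x : free_value V T) i (cls f).
  have [T f|T f v [x [/esym/mI -> ->]]|S T a f y v [x [-> ->]]|psi [psiC psiE]] :=
    @cocone_exists _ _ k_char0 U_replete U_multiplicative U_global Y (model_group i) (V i) Gam.
  - split=> [|c y z v w [x [-> ->]] [x' [-> ->]]].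
      by exists 0; rewrite !linear0 iprod0E ffunE.
    by exists (c *: x + x'); rewrite !linearP iprodDE iprodZE !ffunE.
  - by rewrite linear0 iprod0E ffunE.
  - exists (pull X a x); rewrite -act_cls !at_act; split=> //.
    by rewrite -cls_comp act_free_comp.
  have {}psiE (T : member U) (f : epi T (model_group i)) x :
      psi T f (nat_at m T x) = (nat_at h T x : free_value V T) i (cls f).
    by apply: psiE; exists x.
  have [chi [chiC chiR chiE]] := reduction U_multiplicative U_global psiC.
  exists chi; split=> // T f x; rewrite chiE // => Q r ninj.
  set s := fiber U_multiplicative U_global (epi_comp r f) r.
  have -> : spread U_multiplicative U_global r psi f (nat_at m T x) =
      psi (apex s) (right_leg s) (nat_at m _ (pull X (left_leg s) x)).
    by rewrite -!act_cls at_act.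
  rewrite psiE -act_cls at_act act_freeE big1 // => c /eqP.
  have [g ->] := cls_surj c; rewrite cls_comp => /cls_eq[w right_s].
  have [z rz z1] : exists2 z, r z = 1%g & z <> 1%g.
    apply: contrapT => nz; apply: ninj => y z ryz; apply: contrapT => yz.
    apply: nz; exists (y * z^-1)%g; first by rewrite epiM epiV ryz mulgV.
    by move/eqP; rewrite -eq_mulgV1 => /eqP.
  have [|y [y1 yz]] := (legs_fiber U_multiplicative U_global (epi_comp r f) r 1%g z).2.
    by rewrite epi1 rz.
  by case: z1; rewrite -yz right_s epi_conjE epi_compE y1 epi1 conj1g.
pose chi i := sval (cid (ext i)).
have chiP i := svalP (cid (ext i)).
have [i|i|g gE] := @map_to_free Y V chi; try by case: (chiP i).
exists g; apply: nat_trans_eq => T x; apply: iprodP => i; apply/ffunP => c.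
have [f ->] := cls_surj c.
rewrite -[LHS]/((nat_at g T (nat_at m T x) : free_value V T) i (cls f)) gE.
have [_ _ chiE] := chiP i; exact: chiE.
Qed.

(** Torsion-freeness says that [f^* x] is nonzero for all [f], which makes the
    prescription [c f^* x |-> c] single-valued. *)
Lemma torsion_free_separation X (T : member U) (x : value X T) :
  torsion_free X -> x <> 0 ->
  exists (i : model U) (p : epi T (model_group i))
      (chi : functionals X (k^o : lmodType k) (model_group i)),
    [/\ cocone chi, reduced U_multiplicative U_global chi & chi T p x <> 0].
Proof.
move=> Xtf x0.
pose Gam (S : member U) (f : epi S T) y (v : k^o) := y = (v : k) *: pull X f x.
have [S f|S f v|S R a f y v ->|psi [psiC psiE]] :=
  @cocone_exists _ _ k_char0 U_replete U_multiplicative U_global X T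
    (k^o : lmodType k) Gam.
- split=> [|c y z v w -> ->]; rewrite /Gam; first by rewrite scale0r.
  by rewrite scalerDl scalerA.
- move=> /esym/eqP; rewrite scaler_eq0 => /orP[/eqP //|/eqP fx0].
  by case: x0; apply: (Xtf S T (cls f)); rewrite linear0; exact: fx0.
- by rewrite /Gam linearZ pull_comp.
apply: (@reduced_separation k U U_replete U_multiplicative U_global X _ T x psi psiC).
rewrite (psiE T (epi_id T) x 1); first by apply/eqP; exact: oner_neq0.
by rewrite /Gam pull_id scale1r.
Qed.

(** One coordinate for each nonzero element at each model, given by a reduced
    cocone that separates it from zero. *)
Lemma torsion_free_embeds X : torsion_free X ->
  exists V (h : nat_trans X (free_functor V)),
    forall (T : member U) x, nat_at h T x = 0 -> x = 0.
Proof.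
move=> Xtf; pose A := {j : model U & value X (model_group j)}.
pose sepfun (a : A) i (chi : functionals X (k^o : lmodType k) (model_group i)) :=
  [/\ cocone chi, reduced U_multiplicative U_global chi &
      exists p, chi (model_group (tag a)) p (tagged a) <> 0].
(* The separating model varies with [a]; choosing a cocone for every pair
   [(a, i)] avoids transport along equalities of models. *)
have sel (a : A) i : exists chi : functionals X (k^o : lmodType k) (model_group i),
    [/\ cocone chi, reduced U_multiplicative U_global chi &
      (exists chi', sepfun a i chi') -> sepfun a i chi].
  have [[chi chiP]|none] := pselect (exists chi, sepfun a i chi).
    by exists chi; case: (chiP).
  exists (fun _ _ _ => 0); split=> //; split=> // T f c x y.
  by rewrite scaler0 addr0.
pose V (i : model U) : lmodType k := iprod (fun _ : A => (k^o : lmodType k)).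
pose chi i : functionals X (V i) (model_group i) :=
  fun T f x a => sval (cid (sel a i)) T f x.
have chiP a i := svalP (cid (sel a i)).
have [i|i|h hE] := @map_to_free X V chi.
- split=> [T f c x y|S T a f x]; apply: iprodP => b;
    have [[bL bN] _ _] := chiP b i; [exact: bL | exact: bN].
- move=> T f x Q r ninj; apply: iprodP => b.
  by have [_ bR _] := chiP b i; apply: bR.
exists V, h => T x hx.
have [j [f [g [fg gf]]]] := model_cover T U_replete.
have hgx : nat_at h _ (pull X g x) = 0 by rewrite -act_cls at_act hx linear0.
have [gx0|/eqP gx0] := eqVneq (pull X g x) 0.
  by rewrite -[x]pull_id -gf pull_comp gx0 linear0.
have [i [p [chi' [chiC' chiR' chi0']]]] := torsion_free_separation Xtf gx0.
pose a : A := Tagged (fun j => value X (model_group j)) (pull X g x).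
have [_ _ []] := chiP a i; first by exists chi'; split=> //; exists p.
move=> _ _ [q]; case.
have := hE _ (pull X g x) i q; rewrite hgx iprod0E ffunE.
by move=> /(congr1 (fun v : V i => v a)) /esym; apply.
Qed.

Lemma retract_torsion_free X Y (s : nat_trans X Y) (r : nat_trans Y X) :
  (forall (T : member U) x, nat_at r T (nat_at s T x) = x) -> torsion_free Y -> torsion_free X.
Proof.
move=> rs Ytf S T a x y axy; rewrite -[x](rs T) -[y](rs T); congr (nat_at r T _).
apply: (Ytf S T a); rewrite -[LHS](at_act s a) -[RHS](at_act s a).
by congr (nat_at s S _).
Qed.

Lemma projective_iff_torsion_free_injective X :
  @Defs.projective (AU U k) X <-> torsion_free X /\ @injective_object (AU U k) X.
Proof.
have comp_at Y Z W (g : nat_trans Z W) (f : nat_trans Y Z) (h : nat_trans Y W) :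
    @Defs.comp (AU U k) _ _ _ g f = h ->
    forall (T : member U) x, nat_at g T (nat_at f T x) = nat_at h T x.
  by move=> <-.
split=> [Xproj|[Xtf Xinj]].
  have [e eE] := @free_map_exists k U (fun i => value X (model_group i)) X (fun i => idfun).
  have e_epic : @Defs.epic (AU U k) _ _ e.
    apply: surjective_epic => T x.
    have [i [f [g [fg gf]]]] := model_cover T U_replete.
    exists (act_on (free_functor _) (cls f) (generator (pull X g x))).
    by rewrite at_act eE act_cls -pull_comp gf pull_id.
  have [s es] := Xproj _ _ e (@Defs.idm (AU U k) X) e_epic.
  split.
    apply: (retract_torsion_free (s := s) (r := e) _ (@free_torsion_free _ _ _)).
    exact: comp_at es.
  move=> Y Z m f m_monic.
  have [g gm] := free_functor_injective (Defs.comp (c := AU U k) s f) m_monic.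
  exists (Defs.comp (c := AU U k) e g).
  by rewrite -(@Defs.compA (AU U k)) gm (@Defs.compA (AU U k)) es comp_idl.
have [V [m mI]] := torsion_free_embeds Xtf.
have [r rm] := Xinj _ _ m (@Defs.idm (AU U k) X) (injective_monic mI).
move=> Y Z e f e_epic.
have [g eg] := free_functor_projective (Defs.comp (c := AU U k) f r) e_epic.
exists (Defs.comp (c := AU U k) g m).
by rewrite (@Defs.compA (AU U k)) eg -(@Defs.compA (AU U k)) rm comp_idr.
Qed.
End FreeObjects.

Theorem proposition15p1 (k : fieldType) (k_char0 : [pchar k]%R =i pred0)
    (U : FinGrp -> Prop) (U_replete : replete U)
    (U_multiplicative : multiplicative_family U)
    (U_global : global_family U) (X : AU U k) :
  projective X <-> torsion_free X /\ injective_object X.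
Proof.
exact: projective_iff_torsion_free_injective k_char0 U_replete U_multiplicative
  U_global X.
Qed.
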